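(* Let $R=R^{A,B,C}_{x,y,z}(a,b,c,a',b',c')$ be a tileable triad hexagon, and let $Q=R^{A_1,B_1,C_1}_{x_1,y_1,z_1}(a_1,b_1,c_1,a_1',b_1',c_1')$ be a triad hexagon obtained from $R$ by a finite sequence of bowtie squeezings. Then $$\frac{M(R)}{M(Q)}=\frac{w^{(R)}\,\dfrac{\kappa_A^{(R)}\kappa_B^{(R)}\kappa_C^{(R)}}{\kappa_{BC}^{(R)}\kappa_{AC}^{(R)}\kappa_{AB}^{(R)}}}{w^{(Q)}\,\dfrac{\kappa_{A_1}^{(Q)}\kappa_{B_1}^{(Q)}\kappa_{C_1}^{(Q)}}{\kappa_{B_1C_1}^{(Q)}\kappa_{A_1C_1}^{(Q)}\kappa_{A_1B_1}^{(Q)}}}.$$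
   Context: Work on the triangular lattice, drawn with one family of lattice lines horizontal. A lozenge is the union of two unit triangles sharing an edge; $M(R)$ denotes the number of lozenge tilings of a region $R$, and $R$ is tileable if $M(R)>0$. Lengths of lattice segments are measured in unit-triangle side lengths; distances from a point or segment to a side of a hexagon (a line parallel to the segment) are measured in lattice spacings (distance between consecutive parallel lattice lines $=1$). The sides of a lattice hexagon with horizontal top and bottom are N, NE, SE, S, SW, NW (clockwise from the top); $\delta(P,N)$ is the distance from the point or segment $P$ to the line containing the N side, etc. Triad hexagons. Let $x,y,z,a,b,c,a',b',c'\ge0$ be integers. Let $A,B,C$ be lattice points forming an up-pointing equilateral triangle of side $f$ ($A$ top, $B$ bottom-left, $C$ bottom-right), with $f\ge a'+b'+c'$ ($f$ = focal distance; $A,B,C$ focal points; $AB,AC,BC$ focal edges). The $(a,a')$-bowtie at $A$: the down-pointing triangle of side $a$ with bottom vertex $A$ union the up-pointing triangle of side $a'$ with top vertex $A$. The $(b,b')$-bowtie at $B$: the up-pointing triangle of side $b'$ with bottom-left vertex $B$ union the down-pointing triangle of side $b$ with top-right vertex $B$. The $(c,c')$-bowtie at $C$: the up-pointing triangle of side $c'$ with bottom-right vertex $C$ union the down-pointing triangle of side $c$ with top-left vertex $C$. Let $H$ be a lattice hexagon with sides N: $x+a+b+c$, NE: $y+a'+b'+c'$, SE: $z+a+b+c$, S: $x+a'+b'+c'$, SW: $y+a+b+c$, NW: $z+a'+b'+c'$ containing the bowties; $R^{A,B,C}_{x,y,z}(a,b,c,a',b',c')$ is $H$ minus the three bowties.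 Bowtie squeezing. Squeezing out the bowtie at $A$ by $d$ units ($0\le d\le a'$): keep $A$ fixed, replace $(a,a')$ by $(a+d,a'-d)$; translate the bowties at $B$ and $C$ by $d$ units in the directions $\overrightarrow{BA}$ and $\overrightarrow{CA}$ respectively; translate the N, NW, NE sides outward and the S, SW, SE sides inward by $d$ lattice spacings. Symmetrically, squeezing out the bowtie at $B$ by $d\le b'$: $B$ fixed, $(b,b')\to(b+d,b'-d)$, bowties at $A,C$ translated $d$ units in directions $\overrightarrow{AB},\overrightarrow{CB}$, sides SW, NW, S outward and NE, N, SE inward by $d$; squeezing out the bowtie at $C$ by $d\le c'$: $C$ fixed, $(c,c')\to(c+d,c'-d)$, bowties at $A,B$ translated $d$ units in directions $\overrightarrow{AC},\overrightarrow{BC}$, sides SE, NE, S outward and NW, N, SW inward by $d$. Squeezing in (by at most the outer lobe size) is the inverse operation. A bowtie squeezing is any of these operations; each yields a triad hexagon. Weights and couples. The hyperfactorial is $H(0)=1$, $H(n)=0!\,1!\cdots(n-1)!$ for $n\ge1$. For a triad hexagon with bowtie types $(a,a'),(b,b'),(c,c')$ and focal distance $f$, its weight is $$w=\frac{H(f)^4H(a)H(b)H(c)H(a')H(b')H(c')}{H(f+a)H(f+b)H(f+c)H(f-a')H(f-b')H(f-c')}.$$ Its couples are $\kappa_A=H(\delta(A,N))H(\delta(A,S))$, $\kappa_B=H(\delta(B,NE))H(\delta(B,SW))$, $\kappa_C=H(\delta(C,NW))H(\delta(C,SE))$, $\kappa_{BC}=H(\delta(BC,N))H(\delta(BC,S))$,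 $\kappa_{AC}=H(\delta(AC,NE))H(\delta(AC,SW))$, $\kappa_{AB}=H(\delta(AB,NW))H(\delta(AB,SE))$; a superscript $(R)$ indicates the region with respect to which they are computed. *)

(* Defs.v *)
From mathcomp Require Import all_boot all_order all_algebra.
Unset Printing Implicit Defensive.
Import Order.TTheory GRing.Theory Num.Theory.

(* The lattice point (i,j) : int * int sits at  i*e1 + j*e2  with           *)
(* e1 = (1,0), e2 = (1/2, sqrt 3/2).  The three families of lattice lines   *)
(* are  j = const (horizontal),  i = const (direction e2)  and              *)
(* i + j = const (direction e2 - e1); consecutive parallel lines are at     *)
(* distance one lattice spacing.                                            *)
(* Unit triangles:  (true, i, j)  = up triangle with vertices               *)
(*   (i,j), (i+1,j), (i,j+1);                                               *)
(*                  (false, i, j) = down triangle with vertices             *)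
(*   (i+1,j), (i,j+1), (i+1,j+1).                                           *)

Local Open Scope ring_scope.

Definition pt := (int * int)%type.
Definition tri := (bool * int * int)%type.

Definition tri_verts (t : tri) : seq pt :=
  let: (u, i, j) := t in
  if u then [:: (i, j); (i + 1, j); (i, j + 1)]
  else [:: (i + 1, j); (i, j + 1); (i + 1, j + 1)].

(* The down triangle sharing an edge with the up triangle (true,i,j):
   k = 0 : across the edge (i+1,j)-(i,j+1);
   k = 1 : across the edge (i,j)-(i,j+1);
   k = 2 : across the edge (i,j)-(i+1,j). *)
Definition up_nbr (t : tri) (k : 'I_3) : tri :=
  let: (_, i, j) := t in
  if val k == 0%N then (false, i, j)
  else if val k == 1%N then (false, i - 1, j)
  else (false, i, j - 1).

(* A region is a finite list of unit triangles. A lozenge is the union of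
   two unit triangles sharing an edge; such a pair always consists of one up
   and one down triangle.  A lozenge tiling of r is thus the same as a choice,
   for every up triangle of r, of one of its three neighbouring down
   triangles, such that this assignment is a bijection onto the down
   triangles of r.  M r counts these. *)
Definition ups (r : seq tri) : seq tri := [seq t <- undup r | t.1.1].
Definition downs (r : seq tri) : seq tri := [seq t <- undup r | ~~ t.1.1].

Definition is_tiling (r : seq tri) (g : {ffun 'I_(size (ups r)) -> 'I_3}) : bool :=
  perm_eq [seq up_nbr (nth (true, 0, 0) (ups r) k) (g k) | k : 'I_(size (ups r)) <- enum 'I_(size (ups r))]
          (downs r).

Definition M (r : seq tri) : nat := #|[pred g | is_tiling r g]|.

(*  Hexagon H = { jS <= j <= jN,  sS <= i + j <= sN,  iW <= i <= iE }:      *)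
(*    N side on j = jN, S side on j = jS, NE side on i+j = sN,              *)
(*    SW side on i+j = sS, SE side on i = iE, NW side on i = iW.            *)

Record triad := Triad {
  tx : nat; ty : nat; tz : nat;
  ta : nat; tb : nat; tc : nat;
  ta' : nat; tb' : nat; tc' : nat;
  tf : nat;
  fp : int; fq : int;
  jN : int; jS : int; sN : int; sS : int; iE : int; iW : int }.

Definition ptA (T : triad) : pt := (fp T, fq T + (tf T)%:Z).
Definition ptB (T : triad) : pt := (fp T, fq T).
Definition ptC (T : triad) : pt := (fp T + (tf T)%:Z, fq T).

Definition inH (T : triad) (v : pt) : bool :=
  let: (i, j) := v in
  [&& jS T <= j <= jN T, sS T <= i + j <= sN T & iW T <= i <= iE T].

(* Up-pointing lattice triangle with bottom-left vertex v and side s, and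
   down-pointing lattice triangle with bottom vertex w and side s,
   as closed point sets, and their corners. *)
Definition in_up_tri (v : pt) (s : nat) (u : pt) : bool :=
  [&& v.1 <= u.1, v.2 <= u.2 & u.1 + u.2 <= v.1 + v.2 + s%:Z].
Definition in_down_tri (w : pt) (s : nat) (u : pt) : bool :=
  [&& u.2 <= w.2 + s%:Z, u.1 <= w.1 & w.1 + w.2 <= u.1 + u.2].
Definition up_corners (v : pt) (s : nat) : seq pt :=
  [:: v; (v.1 + s%:Z, v.2); (v.1, v.2 + s%:Z)].
Definition down_corners (w : pt) (s : nat) : seq pt :=
  [:: w; (w.1 - s%:Z, w.2 + s%:Z); (w.1, w.2 + s%:Z)].

(* The six lobes of the three bowties:
   (a,a')-bowtie at A : down triangle of side a with bottom vertex A,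
                        up triangle of side a' with top vertex A;
   (b,b')-bowtie at B : up triangle of side b' with bottom-left vertex B,
                        down triangle of side b with top-right vertex B;
   (c,c')-bowtie at C : up triangle of side c' with bottom-right vertex C,
                        down triangle of side c with top-left vertex C. *)
Definition lobeA_out_bot (T : triad) : pt := ptA T.
Definition lobeA_in_bl (T : triad) : pt := ((ptA T).1, (ptA T).2 - (ta' T)%:Z).
Definition lobeB_in_bl (T : triad) : pt := ptB T.
Definition lobeB_out_bot (T : triad) : pt := ((ptB T).1, (ptB T).2 - (tb T)%:Z).
Definition lobeC_in_bl (T : triad) : pt := ((ptC T).1 - (tc' T)%:Z, (ptC T).2).
Definition lobeC_out_bot (T : triad) : pt :=
  ((ptC T).1 + (tc T)%:Z, (ptC T).2 - (tc T)%:Z).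

Definition in_bowties (T : triad) (u : pt) : bool :=
  [|| in_down_tri (lobeA_out_bot T) (ta T) u, in_up_tri (lobeA_in_bl T) (ta' T) u,
      in_up_tri (lobeB_in_bl T) (tb' T) u, in_down_tri (lobeB_out_bot T) (tb T) u,
      in_up_tri (lobeC_in_bl T) (tc' T) u | in_down_tri (lobeC_out_bot T) (tc T) u].

Definition bowties_in_H (T : triad) : bool :=
  all (inH T) (down_corners (lobeA_out_bot T) (ta T) ++ up_corners (lobeA_in_bl T) (ta' T)
            ++ up_corners (lobeB_in_bl T) (tb' T) ++ down_corners (lobeB_out_bot T) (tb T)
            ++ up_corners (lobeC_in_bl T) (tc' T) ++ down_corners (lobeC_out_bot T) (tc T)).

Definition triad_ok (T : triad) : Prop :=
  (ta' T + tb' T + tc' T <= tf T)%N /\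
      (* side lengths N, NE, SE, S, SW, NW *)
      sN T - jN T - iW T = (tx T + ta T + tb T + tc T)%:Z /\
      jN T + iE T - sN T = (ty T + ta' T + tb' T + tc' T)%:Z /\
      sN T - iE T - jS T = (tz T + ta T + tb T + tc T)%:Z /\
      iE T + jS T - sS T = (tx T + ta' T + tb' T + tc' T)%:Z /\
      sS T - iW T - jS T = (ty T + ta T + tb T + tc T)%:Z /\
      jN T - sS T + iW T = (tz T + ta' T + tb' T + tc' T)%:Z /\
      bowties_in_H T.

Definition tri_in (P : pt -> bool) (t : tri) : bool := all P (tri_verts t).

Definition candidate_tris (T : triad) : seq tri :=
  flatten [seq [seq (u, iW T + k%:Z, jS T + l%:Z) | k <- iota 0 `|iE T - iW T|,
                                                  l <- iota 0 `|jN T - jS T|]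
          | u <- [:: true; false]].

Definition region (T : triad) : seq tri :=
  [seq t <- candidate_tris T | tri_in (inH T) t &&
     ~~ [|| tri_in (in_down_tri (lobeA_out_bot T) (ta T)) t,
            tri_in (in_up_tri (lobeA_in_bl T) (ta' T)) t,
            tri_in (in_up_tri (lobeB_in_bl T) (tb' T)) t,
            tri_in (in_down_tri (lobeB_out_bot T) (tb T)) t,
            tri_in (in_up_tri (lobeC_in_bl T) (tc' T)) t |
            tri_in (in_down_tri (lobeC_out_bot T) (tc T)) t]].

Definition squeeze_out_A (d : nat) (T T' : triad) : Prop :=
  (d <= ta' T)%N /\
  T' = Triad (tx T) (ty T) (tz T) (ta T + d) (tb T) (tc T) (ta' T - d) (tb' T) (tc' T)
             (tf T - d) (fp T) (fq T + d%:Z)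
             (jN T + d%:Z) (jS T + d%:Z) (sN T + d%:Z) (sS T + d%:Z) (iE T - d%:Z) (iW T - d%:Z).

Definition squeeze_out_B (d : nat) (T T' : triad) : Prop :=
  (d <= tb' T)%N /\
  T' = Triad (tx T) (ty T) (tz T) (ta T) (tb T + d) (tc T) (ta' T) (tb' T - d) (tc' T)
             (tf T - d) (fp T) (fq T)
             (jN T - d%:Z) (jS T - d%:Z) (sN T - d%:Z) (sS T - d%:Z) (iE T - d%:Z) (iW T - d%:Z).

Definition squeeze_out_C (d : nat) (T T' : triad) : Prop :=
  (d <= tc' T)%N /\
  T' = Triad (tx T) (ty T) (tz T) (ta T) (tb T) (tc T + d) (ta' T) (tb' T) (tc' T - d)
             (tf T - d) (fp T + d%:Z) (fq T)
             (jN T - d%:Z) (jS T - d%:Z) (sN T + d%:Z) (sS T + d%:Z) (iE T + d%:Z) (iW T + d%:Z).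

Definition squeeze_out (T T' : triad) : Prop :=
  exists d, [\/ squeeze_out_A d T T', squeeze_out_B d T T' | squeeze_out_C d T T'].

Definition squeeze_step (T T' : triad) : Prop :=
  [/\ triad_ok T, triad_ok T' & squeeze_out T T' \/ squeeze_out T' T].

Inductive squeeze_seq : triad -> triad -> Prop :=
  | sq_refl T : squeeze_seq T T
  | sq_cons T T' T'' : squeeze_step T T' -> squeeze_seq T' T'' -> squeeze_seq T T''.

Definition hyperfact (n : nat) : nat := \prod_(i < n) i`!.

(* Hyperfactorial of a distance (distances are nonnegative for valid data). *)
Definition Hd (n : int) : nat := hyperfact `|n|%N.

Definition weight (T : triad) : rat :=
  let f := tf T in
  ((hyperfact f ^ 4 * hyperfact (ta T) * hyperfact (tb T) * hyperfact (tc T)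
    * hyperfact (ta' T) * hyperfact (tb' T) * hyperfact (tc' T))%N%:R)
  / ((hyperfact (f + ta T) * hyperfact (f + tb T) * hyperfact (f + tc T)
     * hyperfact (f - ta' T) * hyperfact (f - tb' T) * hyperfact (f - tc' T))%N%:R).

(* Distances from A, B, C and from the focal edges to the sides of H. *)
Definition kappaA (T : triad) : nat := Hd (jN T - (ptA T).2) * Hd ((ptA T).2 - jS T).
Definition kappaB (T : triad) : nat :=
  Hd (sN T - ((ptB T).1 + (ptB T).2)) * Hd ((ptB T).1 + (ptB T).2 - sS T).
Definition kappaC (T : triad) : nat := Hd ((ptC T).1 - iW T) * Hd (iE T - (ptC T).1).
(* BC lies on j = fq, AC on i + j = fp + fq + f, AB on i = fp. *)
Definition kappaBC (T : triad) : nat := Hd (jN T - fq T) * Hd (fq T - jS T).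
Definition kappaAC (T : triad) : nat :=
  Hd (sN T - (fp T + fq T + (tf T)%:Z)) * Hd (fp T + fq T + (tf T)%:Z - sS T).
Definition kappaAB (T : triad) : nat := Hd (fp T - iW T) * Hd (iE T - fp T).

Definition couple_ratio (T : triad) : rat :=
  ((kappaA T * kappaB T * kappaC T)%N%:R) / ((kappaBC T * kappaAC T * kappaAB T)%N%:R).

(* Main.v *)
(* Squeezing out a bowtie by d units is a d-fold composition of unit squeezes, and the
   rotation by 120 degrees permutes the bowties, so it suffices to squeeze A by one unit.
   Cut the hexagon along the line AB. Tilings are grouped by the set Y of heights at which
   a lozenge crosses the line: M = sum over Y of (left count) * (right count). The lobes of
   A and B and the parts of the two hexagon sides that stick out only add fixed heights to
   Y, because of forced lozenges.
   Slicing by lines parallel to AB, a half with crossing heights D is counted by a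
   determinant det(phi_i(d)), d in D, where the functions phi_i span a space V: a plain
   strip replaces V by the functions whose difference lies in V, and the strips through the
   bowtie at C do the same separately above and below the hole. The unit squeeze removes
   from D_right, and adds to D_left, the height alpha of the unit segment of AB just below
   A, and changes the number of strips of each half by one. Multiplication by s - alpha maps
   the smaller V onto the functions of the larger V vanishing at alpha (by induction on the
   strips; at the bowtie this is where the position of C enters). Hence for every Y both
   counts change by the factor prod over D of |d - alpha|, up to constants; the factors for
   d in Y cancel in the product of the two halves, and the ratio of tilings is the ratio of
   each term. The constants are determinants of triangular matrices and products of the
   remaining |d - alpha|, i.e. factorials. *)

Require Import Defs.
From mathcomp Require Import all_boot all_order all_algebra zify ring.
Import Order.TTheory GRing.Theory Num.Theory.
Local Open Scope ring_scope.
Set Implicit Arguments.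
Unset Strict Implicit.

(** * Perfect matchings of bipartite relations *)

(** Neither half is evaluated in closed form; only the quotient of two of its determinants is
    needed. It comes from one identity, [eig]: if V is the span of the coordinates of [phi], the
    difference of (A - s) v lies in V for every v in V, with a matrix B. One more strip to the left
    replaces [phi] by an antidifference, A by A + 1 and B by B + 1, up to a constant of summation.
    Hence A is 0 on the vertical line through C and climbs by one per strip, that is, it follows the
    line CA and reaches alpha at AB. Plain strips, and strips through the outer lobe of C, add
    constant functions to V, which absorb the constant of summation. Along the inner lobe nothing is
    added and the constant has to vanish; it does because A is there the upper end of the lobe. The
    normalising constant is det B. It has to be tracked as the polynomial det(B + x), since every
    later strip shifts B; each new coordinate contributes a triangular block, so the result is a
    product of rising factorials. *)

Section Matchings.
Context {T1 T2 : Type}.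
Implicit Types (e : T1 -> T2 -> bool) (us : seq T1) (ws : seq T2).

Fixpoint picks {T : Type} (s : seq T) : seq (T * seq T) :=
  if s is x :: s' then (x, s') :: [seq (p.1, x :: p.2) | p <- picks s'] else [::].

Fixpoint splits {T : Type} (s : seq T) : seq (seq T * seq T) :=
  if s is x :: s' then [seq (x :: p.1, p.2) | p <- splits s'] ++
                       [seq (p.1, x :: p.2) | p <- splits s']
  else [:: ([::], [::])].

(** With a recursion on lists, cutting a region, deleting forced pairs and exchanging the two
    colours are list inductions; [card_matchings] ties it to the functions counted by [M]. *)
Fixpoint matchings e us ws : nat :=
  if us is u :: us' then (\sum_(p <- picks ws | e u p.1) matchings e us' p.2)%N
  else nilp ws.

(** Both sides enumerate the ways to choose one entry and to split the remaining ones. This is what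
    lets a vertex take its partner inside the block allotted to its group. *)
Lemma sum_splits_picks {T : Type} (h : T -> seq T -> seq T -> nat) (s : seq T) :
  (\sum_(q <- picks s) \sum_(p <- splits q.2) h q.1 p.1 p.2
   = \sum_(p <- splits s) \sum_(q <- picks p.1) h q.1 q.2 p.2)%N.
Proof.
elim: s h => [|x s IH] h /=; first by rewrite big_nil big_cons !big_nil.
rewrite big_cons big_cat !big_map /=.
under [X in (_ + X)%N]eq_bigr do rewrite big_cat !big_map /=.
rewrite big_split /= [X in (_ + (X + _))%N](IH (fun y X Y => h y (x :: X) Y)).
rewrite [X in (_ + (_ + X))%N](IH (fun y X Y => h y X (x :: Y))) addnA.
congr (_ + _)%N; rewrite -big_split /=; apply: eq_bigr => p _.
by rewrite big_cons big_map.
Qed.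

Lemma sum_splits_cat {T : Type} (h : seq T -> seq T -> nat) (s t : seq T) :
  (\sum_(p <- splits (s ++ t)) h p.1 p.2
   = \sum_(p <- splits s) \sum_(q <- splits t) h (p.1 ++ q.1) (p.2 ++ q.2))%N.
Proof.
elim: s h => [|x s IH] h /=; first by rewrite big_cons big_nil addn0.
rewrite !big_cat !big_map /= (IH (fun X Y => h (x :: X) Y)).
by rewrite (IH (fun X Y => h X (x :: Y))).
Qed.

Lemma sum_splits_left {T : eqType} (h : seq T -> seq T -> nat) (s : seq T) :
  (forall X Y y, y \in Y -> y \in s -> h X Y = 0%N) ->
  (\sum_(p <- splits s) h p.1 p.2 = h s [::])%N.
Proof.
elim: s h => [|x s IH] h hz /=; first by rewrite big_cons big_nil addn0.
rewrite big_cat !big_map /= (IH (fun X Y => h (x :: X) Y)); last first.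
  by move=> X Y y yY ys; apply: hz yY _; rewrite inE ys orbT.
rewrite [X in (_ + X)%N]big1 ?addn0 // => p _.
by apply: (hz _ _ x); rewrite inE eqxx.
Qed.

Lemma sum_splits_right {T : eqType} (h : seq T -> seq T -> nat) (s : seq T) :
  (forall X Y x, x \in X -> x \in s -> h X Y = 0%N) ->
  (\sum_(p <- splits s) h p.1 p.2 = h [::] s)%N.
Proof.
elim: s h => [|x s IH] h hz /=; first by rewrite big_cons big_nil addn0.
rewrite big_cat !big_map /= (IH (fun X Y => h X (x :: Y))); last first.
  by move=> X Y y yX ys; apply: hz yX _; rewrite inE ys orbT.
rewrite [X in (X + _)%N]big1 // => p _.
by apply: (hz _ _ x); rewrite inE eqxx.
Qed.

Lemma sum_splits_nil {T : Type} (h : seq T -> nat) (s : seq T) :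
  (\sum_(p <- splits s) nilp p.1 * h p.2 = h s)%N.
Proof.
elim: s h => [|x s IH] h /=; first by rewrite big_cons big_nil mul1n addn0.
by rewrite big_cat !big_map /= big1 ?add0n // (IH (fun l => h (x :: l))).
Qed.

Lemma matchings_cat_left e us1 us2 ws :
  matchings e (us1 ++ us2) ws = (\sum_(p <- splits ws) matchings e us1 p.1 * matchings e us2
    p.2)%N.
Proof.
elim: us1 ws => [|u us IH] ws /=.
  by rewrite (sum_splits_nil (matchings e us2)).
under eq_bigr do rewrite IH.
rewrite big_mkcond /=.
transitivity (\sum_(q <- picks ws) \sum_(p <- splits q.2)
    e u q.1 * matchings e us p.1 * matchings e us2 p.2)%N.
  apply: eq_bigr => q _; case: (e u q.1); last by rewrite big1.
  by apply: eq_bigr => p _; rewrite mul1n.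
rewrite (sum_splits_picks (fun w X Y => e u w * matchings e us X * matchings e us2 Y)%N).
apply: eq_bigr => p _; rewrite big_distrl /= [RHS]big_mkcond /=.
by apply: eq_bigr => q _; case: (e u q.1); rewrite ?mul1n ?mul0n.
Qed.

(** The recursion favours the left vertices. Expanding along a right vertex gives the symmetry
    [matchings_tr] and allows forced down triangles to be removed. *)
Lemma matchings_cons_r e us w ws :
  matchings e us (w :: ws) = (\sum_(p <- picks us | e p.1 w) matchings e p.2 ws)%N.
Proof.
elim: us ws => [|u us IH] ws /=; first by rewrite big_nil.
rewrite !big_cons !big_map /=.
have -> : (\sum_(p <- picks ws | e u p.1) matchings e us (w :: p.2) =
   \sum_(p <- picks us | e p.1 w) \sum_(q <- picks ws | e u q.1) matchings e p.2 q.2)%N.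
  by under eq_bigr do rewrite IH; rewrite exchange_big.
by [].
Qed.
End Matchings.

Lemma matchings_tr {T1 T2 : Type} (e : T1 -> T2 -> bool) us ws :
  matchings e us ws = matchings (fun w u => e u w) ws us.
Proof.
elim: ws us => [|w ws IH] us; first by case: us => //= u us; rewrite big_nil.
by rewrite matchings_cons_r /=; apply: eq_bigr => p _; rewrite IH.
Qed.

Lemma picks_map {T T' : Type} (f : T -> T') s :
  picks [seq f x | x <- s] = [seq (f p.1, [seq f x | x <- p.2]) | p <- picks s].
Proof.
elim: s => //= x s ->; congr cons.
by rewrite -!map_comp.
Qed.

Lemma splits_map {T T' : Type} (f : T -> T') s :
  splits [seq f x | x <- s]
  = [seq ([seq f x | x <- p.1], [seq f x | x <- p.2]) | p <- splits s].
Proof. by elim: s => //= x s ->; rewrite map_cat -!map_comp. Qed.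

Lemma matchings_map {T1 T2 T1' T2' : Type} (e : T1 -> T2 -> bool) (e' : T1' -> T2' -> bool)
    (f : T1 -> T1') (g : T2 -> T2') us ws :
  (forall u w, e' (f u) (g w) = e u w) ->
  matchings e' [seq f u | u <- us] [seq g w | w <- ws] = matchings e us ws.
Proof.
move=> H; elim: us ws => [|u us IH] ws /=; first by case: ws.
rewrite picks_map big_map /=; apply: eq_big => [p|p _]; rewrite ?H //.
Qed.

Section MatchingsEq.
Context {T1 T2 : eqType}.
Implicit Types (e : T1 -> T2 -> bool) (us : seq T1) (ws : seq T2).

Lemma picks_uniq {T : eqType} (s : seq T) : uniq s -> picks s = [seq (x, rem x s) | x <- s].
Proof.
elim: s => //= x s IH /andP[xs us]; rewrite eqxx IH // -map_comp; congr cons.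
apply/eq_in_map => y ys /=; case: eqP => // exy; by rewrite exy ys in xs.
Qed.

Lemma picks_perm {T : eqType} (s : seq T) p : p \in picks s -> perm_eq s (p.1 :: p.2).
Proof.
elim: s p => //= y s IHs p; rewrite in_cons => /orP[/eqP-> //|].
case/mapP=> -[z t] /IHs zt -> /=.
by rewrite perm_sym (perm_catCA [:: z] [:: y]) /= perm_cons perm_sym.
Qed.

Lemma matchings_perm_r e us ws ws' :
  uniq ws -> perm_eq ws ws' -> matchings e us ws = matchings e us ws'.
Proof.
elim: us ws ws' => [|u us IH] ws ws' Hu Hp /=.
  by rewrite /nilp (perm_size Hp).
rewrite !picks_uniq // -?(perm_uniq Hp) // !big_map /= (perm_big _ Hp) /=.
rewrite [LHS]big_seq_cond [RHS]big_seq_cond.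
apply: eq_bigr => w /andP[ww' _]; apply: IH; first exact: rem_uniq.
rewrite -(perm_cons w) (perm_trans _ (perm_to_rem ww')) // perm_sym.
by rewrite (perm_trans _ (perm_to_rem (etrans (perm_mem Hp w) ww'))) // perm_sym.
Qed.

Lemma matchings_isolated e us ws w : w \in ws -> (forall u, u \in us -> ~~ e u w) -> matchings e
  us ws = 0%N.
Proof.
elim: us ws => [|u us IH] ws wws H /=; first by case: ws wws.
rewrite big_seq_cond big1 //= => -[x r] /andP[xr exu]; apply: IH; last first.
  by move=> v vus; rewrite H // in_cons vus orbT.
have /perm_mem/(_ w) := picks_perm xr; rewrite wws in_cons => /esym/orP[/eqP wx|//].
by move: exu; rewrite /= -[x]wx (negbTE (H u _)) ?in_cons ?eqxx.
Qed.
End MatchingsEq.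

Lemma matchings_perm_l {T1 T2 : eqType} (e : T1 -> T2 -> bool) us us' ws :
  uniq us -> perm_eq us us' -> matchings e us ws = matchings e us' ws.
Proof. by move=> Hu Hp; rewrite !(matchings_tr e); apply: matchings_perm_r. Qed.

Lemma splits_perm {T : eqType} (s : seq T) p : p \in splits s -> perm_eq s (p.1 ++ p.2).
Proof.
elim: s p => [|x s IH] p /=; first by rewrite inE => /eqP->.
rewrite mem_cat => /orP[] /mapP[q /IH qs ->] /=; first by rewrite perm_cons.
by rewrite perm_sym perm_catC /= perm_cons perm_catC perm_sym.
Qed.

Lemma splits_subseq_r {T : eqType} (s : seq T) p : p \in splits s -> subseq p.2 s.
Proof.
elim: s p => [|x s IH] p /=; first by rewrite inE => /eqP->.
rewrite mem_cat => /orP[] /mapP[q /IH qs ->] /=; last by rewrite eqxx.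
exact: subseq_trans (subseq_cons s x).
Qed.

Lemma splits_subseq_l {T : eqType} (s : seq T) p : p \in splits s -> subseq p.1 s.
Proof.
elim: s p => [|x s IH] p /=; first by rewrite inE => /eqP->.
rewrite mem_cat => /orP[] /mapP[q /IH qs ->] /=; first by rewrite eqxx.
exact: subseq_trans (subseq_cons s x).
Qed.

(** [A] is out of reach of [us2] and [C] of [us1], so only [B] has to be distributed between the two
    groups. *)
Lemma matchings_cat {T1 T2 : eqType} (e : T1 -> T2 -> bool) (us1 us2 : seq T1) (A B C : seq T2) :
  (forall u w, u \in us2 -> w \in A -> ~~ e u w) ->
  (forall u w, u \in us1 -> w \in C -> ~~ e u w) ->
  matchings e (us1 ++ us2) (A ++ B ++ C)
  = (\sum_(p <- splits B) matchings e us1 (A ++ p.1) * matchings e us2 (p.2 ++ C))%N.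
Proof.
move=> HA HC; rewrite matchings_cat_left.
rewrite (sum_splits_cat (fun X Y => matchings e us1 X * matchings e us2 Y)%N).
rewrite (@sum_splits_left _ (fun X Y => \sum_(q <- splits (B ++ C))
  matchings e us1 (X ++ q.1) * matchings e us2 (Y ++ q.2))%N); last first.
  move=> X Y y yY yA; rewrite big1 // => q _.
  by rewrite [matchings e us2 _](matchings_isolated (w := y)) ?muln0 ?mem_cat ?yY // => u uu;
    apply: HA.
rewrite /= (sum_splits_cat (fun X Y => matchings e us1 (A ++ X) * matchings e us2 Y)%N).
apply: eq_bigr => p _.
rewrite (@sum_splits_right _ (fun X Y => matchings e us1 (A ++ p.1 ++ X) * matchings e us2 (p.2
  ++ Y))%N).
  by rewrite cats0.
move=> X Y x xX xC; rewrite (matchings_isolated (w := x)) ?mul0n // => [|u uu]; last exact: HC.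
by rewrite !mem_cat xX !orbT.
Qed.

Definition nbrs (u : tri) : seq tri := [seq up_nbr u k | k <- enum 'I_3].
Definition adj (u w : tri) : bool := w \in nbrs u.

Lemma nbrsE u : nbrs u =
  [:: (false, u.1.2, u.2); (false, u.1.2 - 1, u.2); (false, u.1.2, u.2 - 1)].
Proof. by rewrite /nbrs !enum_ordSl enum_ord0 /=; case: u => [[b i] j]. Qed.

Lemma nbrs_uniq u : uniq (nbrs u).
Proof.
by rewrite nbrsE /= !in_cons !in_nil !xpair_eqE; lia.
Qed.

Lemma adjE b i j b' i' j' : adj (b, i, j) (b', i', j') =
  [&& ~~ b', i - 1 <= i', j - 1 <= j', i' <= i, j' <= j & i + j - 1 <= i' + j'].
Proof. by rewrite /adj nbrsE /= !in_cons in_nil !xpair_eqE; lia. Qed.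

Lemma big_ffun_ordS n (T : finType) (F : {ffun 'I_n.+1 -> T} -> nat) :
  (\sum_g F g
   = \sum_k \sum_(g : {ffun 'I_n -> T}) F [ffun i => oapp g k (unlift ord0 i)])%N.
Proof.
rewrite pair_big /=.
rewrite (reindex (fun p : T * {ffun 'I_n -> T} => [ffun i => oapp p.2 p.1 (unlift ord0 i)])) //=.
exists (fun g : {ffun 'I_n.+1 -> T} => (g ord0, [ffun i => g (lift ord0 i)])) => [[k g]|g] _ /=.
  rewrite ffunE unlift_none; congr pair; apply/ffunP => i.
  by rewrite !ffunE liftK.
apply/ffunP => i; rewrite ffunE.
by case: unliftP => [j|] -> //=; rewrite ffunE.
Qed.

Lemma card_matchings (us ws : seq tri) x0 (Hu : uniq ws) :
  #|[pred g : {ffun 'I_(size us) -> 'I_3} |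
      perm_eq [seq up_nbr (nth x0 us k) (g k) | k : 'I_(size us) <- enum 'I_(size us)] ws]|
  = matchings adj us ws.
Proof.
elim: us ws Hu => [|u us IH] ws Hu.
  rewrite {Hu} (eq_card (B := if nilp ws then predT else pred0)).
    by case: ws => [|w ws] /=; rewrite ?card0 // card_ffun !card_ord expn0.
  move=> g; rewrite inE enum_ord0 /=; case: ws => [|w ws] //=.
  by apply/negbTE/negP => /perm_size.
rewrite -sum1_card big_mkcond big_ffun_ordS /= picks_uniq // big_map /=.
rewrite -[RHS]big_filter.
(* The three neighbours of [u] are distinct, so choosing a direction [k] is the same as choosing a
   partner in [ws]. *)
have Hp : perm_eq [seq w <- ws | adj u w] [seq w <- nbrs u | w \in ws].
  apply: uniq_perm; rewrite ?filter_uniq ?nbrs_uniq // => w.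
  by rewrite !mem_filter andbC.
rewrite (perm_big _ Hp) /=.
rewrite big_filter /nbrs big_map [RHS]big_mkcond big_enum /=.
apply: eq_bigr => k _; case: ifP => Hk; last first.
  rewrite big1 // => g _; rewrite inE enum_ordSl /= ffunE unlift_none /=.
  by case: ifP => // /perm_mem/(_ (up_nbr u k)); rewrite in_cons eqxx Hk.
rewrite -IH ?rem_uniq // -sum1_card [RHS]big_mkcond /=.
apply: eq_bigr => g _; rewrite !inE enum_ordSl /= ffunE unlift_none /=.
have -> : perm_eq (up_nbr u k :: [seq up_nbr (nth x0 (u :: us) i)
    ([ffun j => oapp g k (unlift ord0 j)] i) | i : 'I_(size us).+1 <- [seq lift ord0 i | i <-
      enum 'I_(size us)]]) ws
  = perm_eq [seq up_nbr (nth x0 us i) (g i) | i : 'I_(size us) <- enum 'I_(size us)] (rem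
    (up_nbr u k) ws).
  rewrite (permPr (perm_to_rem Hk)) perm_cons -map_comp.
  by congr perm_eq; apply: eq_map => i /=; rewrite ffunE liftK.
by [].
Qed.

Lemma M_matchings r : M r = matchings adj (ups r) (downs r).
Proof. exact: card_matchings (filter_uniq _ (undup_uniq _)). Qed.

(** * Determinants of lists of row vectors *)

Section ListDeterminant.
Context {R : comNzRingType}.

(* Determinant of a list of row vectors; [0] when the list has the wrong length. *)
Definition ldet n (l : seq 'rV[R]_n) : R :=
  if size l == n then \det (\matrix_(i < n) nth 0 l i) else 0.

Lemma nth_cat_mid (T : Type) (x0 : T) l1 x y l2 j : j != size l1 ->
  nth x0 (l1 ++ x :: l2) j = nth x0 (l1 ++ y :: l2) j.
Proof.
move=> nj; rewrite !nth_cat; case: ltnP => //; case: ltngtP nj => // lj _ _.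
by rewrite -(subnSK lj).
Qed.

Lemma ldet_lin n (a b : R) (x y : 'rV[R]_n) l1 l2 :
  ldet (l1 ++ (a *: x + b *: y) :: l2) = a * ldet (l1 ++ x :: l2) + b * ldet (l1 ++ y :: l2).
Proof.
rewrite /ldet !size_cat /=; case: eqP => [Hn|_]; last by rewrite !mulr0 addr0.
have lt1 : (size l1 < n)%N by rewrite -[ltnRHS]Hn addnS ltnS leq_addr.
have nth_mid z : nth 0 (l1 ++ z :: l2) (size l1) = z by rewrite nth_cat ltnn subnn.
apply: (determinant_multilinear (i0 := Ordinal lt1)).
- by rewrite !rowK /= !nth_mid.
- apply/row_matrixP => j; rewrite !row_rowsub !rowK.
  by apply: nth_cat_mid; rewrite eq_sym; apply: (neq_lift (Ordinal lt1)).
- apply/row_matrixP => j; rewrite !row_rowsub !rowK.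
  by apply: nth_cat_mid; rewrite eq_sym; apply: (neq_lift (Ordinal lt1)).
Qed.

Lemma ldetD n (x y : 'rV[R]_n) l1 l2 :
  ldet (l1 ++ (x + y) :: l2) = ldet (l1 ++ x :: l2) + ldet (l1 ++ y :: l2).
Proof. by have := ldet_lin 1 1 x y l1 l2; rewrite !scale1r !mul1r. Qed.

Lemma ldetZ n a (x : 'rV[R]_n) l1 l2 : ldet (l1 ++ a *: x :: l2) = a * ldet (l1 ++ x :: l2).
Proof. by have := ldet_lin a 0 x 0 l1 l2; rewrite scaler0 addr0 mul0r addr0. Qed.

Lemma ldet0 n (l1 l2 : seq 'rV[R]_n) : ldet (l1 ++ 0 :: l2) = 0.
Proof. by have := ldetZ 0 0 l1 l2; rewrite scaler0 mul0r. Qed.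

Lemma ldet_dup n (x : 'rV[R]_n) l1 l2 l3 : ldet (l1 ++ x :: l2 ++ x :: l3) = 0.
Proof.
rewrite /ldet; case: eqP => // Hn; move: (Hn); rewrite !size_cat /= size_cat /= => Hs.
have lt1 : (size l1 < n)%N by rewrite -[ltnRHS]Hs; lia.
have lt2 : (size l1 + (size l2).+1 < n)%N by rewrite -[ltnRHS]Hs; lia.
apply: (determinant_alternate (i1 := Ordinal lt1) (i2 := Ordinal lt2)).
  by rewrite -val_eqE /=; lia.
move=> j; rewrite !mxE /= !nth_cat ltnn subnn ltnNge leq_addr /= addKn /=.
by rewrite nth_cat ltnn subnn.
Qed.

Lemma ldet_addr n (x v : 'rV[R]_n) l1 l2 l3 :
  ldet (l1 ++ x :: l2 ++ (x + v) :: l3) = ldet (l1 ++ x :: l2 ++ v :: l3).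
Proof.
by rewrite -cat_cons catA ldetD -!catA ldet_dup add0r.
Qed.

Lemma ldet_addl n (x v : 'rV[R]_n) l1 l2 l3 :
  ldet (l1 ++ (x + v) :: l2 ++ x :: l3) = ldet (l1 ++ v :: l2 ++ x :: l3).
Proof. by rewrite ldetD ldet_dup add0r. Qed.

Lemma ldet_translate_r n (x : 'rV[R]_n) l1 l2 :
  ldet (l1 ++ x :: [seq x + v | v <- l2]) = ldet (l1 ++ x :: l2).
Proof.
suff H l' : ldet (l1 ++ x :: l' ++ [seq x + v | v <- l2]) = ldet (l1 ++ x :: l' ++ l2).
  exact: (H [::]).
elim: l2 l' => //= v l2 IH l'; rewrite ldet_addr.
by have := IH (rcons l' v); rewrite !cat_rcons.
Qed.

Lemma ldet_translate n (x : 'rV[R]_n) l1 l2 :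
  ldet ([seq x + v | v <- l1] ++ x :: [seq x + v | v <- l2]) = ldet (l1 ++ x :: l2).
Proof.
rewrite ldet_translate_r.
suff H l : ldet (l ++ [seq x + v | v <- l1] ++ x :: l2) = ldet (l ++ l1 ++ x :: l2).
  exact: (H [::]).
elim: l1 l => //= v l1 IH l; rewrite ldet_addl.
by have := IH (rcons l v); rewrite !cat_rcons.
Qed.

Lemma ldet_scale n (T : Type) (c : T -> R) (f : T -> 'rV[R]_n) s pre post :
  ldet (pre ++ [seq c x *: f x | x <- s] ++ post)
  = (\prod_(x <- s) c x) * ldet (pre ++ map f s ++ post).
Proof.
elim: s pre => [|x s IH] pre /=; first by rewrite big_nil mul1r.
rewrite big_cons ldetZ -mulrA; congr (_ * _).
by have := IH (rcons pre (f x)); rewrite !cat_rcons.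
Qed.

Lemma ldet_mul n (P : 'M[R]_n) l : ldet [seq v *m P | v <- l] = ldet l * \det P.
Proof.
rewrite /ldet size_map; case: eqP => [Hn|]; last by rewrite mul0r.
rewrite -det_mulmx; congr (\det _); apply/row_matrixP => i.
by rewrite row_mul !rowK (nth_map 0) // Hn.
Qed.

Lemma ldet_col0 n (i : 'I_n) (l : seq 'rV[R]_n) : (forall v, v \in l -> v 0 i = 0) -> ldet l = 0.
Proof.
move=> H; rewrite /ldet; case: eqP => // Hn; rewrite (expand_det_col _ i) big1 // => j _.
by rewrite mxE H ?mul0r // mem_nth // Hn.
Qed.

Lemma det_eq_val m n (A : 'M[R]_m) (B : 'M[R]_n) : m = n ->
  (forall (i j : 'I_m) (i' j' : 'I_n), i = i' :> nat -> j = j' :> nat -> A i j = B i' j') ->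
  \det A = \det B.
Proof. by move=> e; case: n / e B => B H; congr (\det _); apply/matrixP => i j; apply: H. Qed.

(** Expansion along the last column gives the sign (-1)^(size l2). It is spread over the rows of
    [l2] because these negated rows later turn factors A - s into s - A. *)
Lemma ldet_border n (w : 'rV[R]_n) (l1 l2 : seq 'rV[R]_n) :
  ldet ([seq row_mx v 0 | v <- l1] ++ row_mx w 1 :: [seq row_mx v 0 | v <- l2])
  = ldet (l1 ++ [seq - v | v <- l2]) :> R.
Proof.
have Hs : ldet (l1 ++ [seq - v | v <- l2]) = (-1) ^+ size l2 * ldet (l1 ++ l2).
  elim: l2 l1 => [|v l2 IH] l1 /=; first by rewrite mul1r.
  rewrite -scaleN1r ldetZ exprS -mulrA; congr (_ * _).
  by have := IH (rcons l1 v); rewrite !cat_rcons.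
rewrite {}Hs /ldet !size_cat /= !size_map addnS -addn1 eqn_add2r.
case: eqP => [Hn|]; last by rewrite mulr0.
rewrite (expand_det_col _ (rshift n ord0)).
have lt1 : (size l1 < n + 1)%N by rewrite addn1 ltnS -[leqRHS]Hn leq_addr.
rewrite (bigD1 (Ordinal lt1)) //= [X in _ + X]big1 ?addr0; last first.
  move=> j nj; rewrite mxE.
  have [jl|jl] := ltnP j (size l1).
    by rewrite nth_cat size_map jl (nth_map 0) // row_mxEr mxE mul0r.
  have nj' : (j != size l1 :> nat) by rewrite -val_eqE in nj.
  have jl' : (size l1 < j)%N by rewrite ltn_neqAle eq_sym nj'.
  rewrite nth_cat size_map ltnNge jl /= -(subnSK jl') /= (nth_map 0).
    by rewrite row_mxEr mxE mul0r.
  rewrite ltn_subLR // addSn Hn ltnS; have := ltn_ord j; lia.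
rewrite mxE /= nth_cat size_map ltnn subnn /= row_mxEr mxE eqxx mul1r.
rewrite /cofactor /= addn0 -[X in (_ + X)%N]Hn addnA exprD -signr_odd oddD addbb mul1r.
congr (_ * _).
apply: det_eq_val => [|i j i' j' ii' jj']; first by rewrite addn1.
rewrite !mxE /= !nth_cat size_map.
have -> : lift (rshift n (ord0 : 'I_1)) j = lshift 1 j' :> 'I_(n + 1).
  apply: val_inj => /=; rewrite /bump jj' addn0 leqNgt.
  by case: ltngtP (ltn_ord j') => // ->; rewrite ltnn.
rewrite /bump -ii'; have [il|il] := ltnP i (size l1).
  by rewrite add0n il (nth_map 0) // row_mxEl.
rewrite add1n ltnNge (leq_trans il (leqnSn _)) /= subSn //= (nth_map 0).
  by rewrite row_mxEl.
by rewrite ltn_subLR // Hn ii'; apply: ltn_ord.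
Qed.
End ListDeterminant.

(** * Integer intervals and matchings inside one strip *)

Definition range (a b : int) : seq int :=
  [seq a + k%:Z | k <- iota 0 (if (b - a)%R is Posz n then n else 0)].

Lemma range_nil a b : b <= a -> range a b = [::].
Proof. by rewrite /range; case E : (b - a) => [[|n]|n] //; lia. Qed.

Lemma range_cons a b : a < b -> range a b = a :: range (a + 1) b.
Proof.
rewrite /range; case E : (b - a) => [[|n]|n] //; try lia; move=> _ /=.
rewrite addr0 (_ : b - (a + 1) = n); last by lia.
rewrite -[1%N]/(1 + 0)%N iotaDl -map_comp; congr cons; apply: eq_map => k /=; lia.
Qed.

Lemma range_ind (P : int -> int -> Prop) :
  (forall a b, b <= a -> P a b) -> (forall a b, a < b -> P (a + 1) b -> P a b) ->
  forall a b, P a b.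
Proof.
move=> H0 H1 a b; have [|ab] := leP b a; first exact: H0.
have [n Hn] : exists n : nat, b - a = n by exists `|b - a|%N; lia.
elim: n a ab Hn => [|n IH] a ab Hn; first by lia.
by apply: H1 => //; have [|ab'] := leP b (a + 1); [apply: H0 | apply: IH => //; lia].
Qed.

Lemma mem_range a b j : (j \in range a b) = (a <= j < b).
Proof.
move: a b; apply: range_ind => a b ab; first by rewrite range_nil // in_nil; lia.
by rewrite (range_cons ab) in_cons => ->; lia.
Qed.

Lemma range_uniq a b : uniq (range a b).
Proof.
move: a b; apply: range_ind => a b ab; first by rewrite range_nil.
by rewrite (range_cons ab) /= mem_range => ->; rewrite andbT; lia.
Qed.

Lemma range_cat a b c : a <= b -> b <= c -> range a c = range a b ++ range b c.
Proof.
move: a b; apply: range_ind => a b ab; first by move=> *; rewrite (range_nil ab); congr range;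
  lia.
move=> IH _ bc; rewrite (range_cons ab) (@range_cons a c) ?IH //; lia.
Qed.

Lemma range_rcons a b : a <= b -> range a (b + 1) = range a b ++ [:: b].
Proof.
move=> ab; rewrite (@range_cat a b) //; last by lia.
by rewrite (@range_cons b) ?(@range_nil (b + 1)) //; lia.
Qed.

(** Only two of the three neighbours of an up triangle lie in its own strip; the third one is in the
    strip to the left, at the same height. *)
Definition strip_adj (u w : int) : bool := (w == u) || (w == u - 1).

Lemma matchings_far (u : int) (us X : seq int) : (forall x, x \in X -> u < x) -> matchings
  strip_adj (u :: us) X = 0%N.
Proof.
move=> H /=; rewrite big_seq_cond big1 // => -[x r] /= /andP[/picks_perm Hp].
have /H : x \in X by rewrite (perm_mem Hp) inE eqxx.
by rewrite /strip_adj; lia.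
Qed.

Lemma matchings_near (u : int) (us : seq int) (x : int) (X : seq int) : strip_adj u x -> (forall
  x, x \in X -> u < x) ->
  matchings strip_adj (u :: us) (x :: X) = matchings strip_adj us X.
Proof.
move=> Hx H /=; rewrite big_cons Hx big_map big_seq_cond big1 ?addn0 //= => -[y r] /=.
case/andP=> /picks_perm Hp; have /H : y \in X by rewrite (perm_mem Hp) inE eqxx.
by rewrite /strip_adj; lia.
Qed.

Lemma matchings_near2 (u : int) (us X : seq int) : (forall x, x \in X -> u < x) ->
  matchings strip_adj (u :: us) [:: u - 1, u & X]%R = (matchings strip_adj us (u :: X) +
    matchings strip_adj us (u - 1 :: X)%R)%N.
Proof.
move=> H /=; rewrite !big_cons /strip_adj /= !eqxx orbT /= -map_comp.
rewrite big_map big_seq_cond big1 ?addn0 //= => -[y r] /=.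
case/andP=> /picks_perm Hp; have /H : y \in X by rewrite (perm_mem Hp) inE eqxx.
by lia.
Qed.

Section Chain.
Context {R : comNzRingType}.

(* A particle entering a strip at [s] may leave it at any [t >= s]; alternation
   of the determinant discards the overlapping choices, as in the
   Lindstroem-Gessel-Viennot lemma. *)
Lemma chain n (y g : int -> 'rV[R]_n) lo hi (D : pred int) pre post :
  (forall s, lo <= s < hi -> g s = y s + g (s + 1)) -> g hi = 0 -> lo <= hi ->
  \sum_(p <- splits (range lo hi))
     (matchings strip_adj [seq j <- range lo hi | ~~ D j] p.1)%:R * ldet (pre ++ map y p.2 ++
       post)
  = ldet (pre ++ map g [seq j <- range lo hi | D j] ++ post).
Proof.
move=> gE ghi lohi.
(* The second statement carries a down triangle just below [lo] that still needs a partner, in other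
   words a particle arriving at [lo] from below; it accounts for the row [g lo]. *)
suff [] : (forall pre, \sum_(p <- splits (range lo hi))
     (matchings strip_adj [seq j <- range lo hi | ~~ D j] p.1)%:R * ldet (pre ++ map y p.2 ++
       post)
  = ldet (pre ++ map g [seq j <- range lo hi | D j] ++ post)) /\
  (forall pre, \sum_(p <- splits (range lo hi))
     (matchings strip_adj [seq j <- range lo hi | ~~ D j] (lo - 1 :: p.1))%:R * ldet (pre ++ map
       y p.2 ++ post)
  = ldet (pre ++ g lo :: map g [seq j <- range lo hi | D j] ++ post)) by [].
move: lo hi gE ghi lohi {pre}; apply: (range_ind (P := fun lo hi => _)) => lo hi lohi.
  move=> _ ghi hilo; rewrite range_nil //= (_ : lo = hi); last by lia.
  split=> pre; rewrite big_cons big_nil /= addr0 ?mul1r // ghi.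
  by rewrite mul0r ldet0.
move=> IH gE ghi _; rewrite (range_cons lohi) /=.
have {IH} [|| P0 P1] := IH _ ghi; [by move=> s Hs; apply: gE; lia | by lia |].
have glo : g lo = y lo + g (lo + 1) by apply: gE; lia.
have far p : p \in splits (range (lo + 1) hi) -> forall x, x \in p.1 -> lo < x.
  move=> /splits_perm/perm_mem Hp x xp; have := Hp x.
  by rewrite mem_cat xp mem_range; lia.
have sumE (F : seq int -> seq int -> R) :
    \sum_(p <- [seq (lo :: q.1, q.2) | q <- splits (range (lo + 1) hi)] ++
               [seq (q.1, lo :: q.2) | q <- splits (range (lo + 1) hi)]) F p.1 p.2
    = \sum_(p <- splits (range (lo + 1) hi)) F (lo :: p.1) p.2
      + \sum_(p <- splits (range (lo + 1) hi)) F p.1 (lo :: p.2).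
  by rewrite big_cat !big_map.
have iso us x X : (forall u, u \in us -> x + 1 < u) -> x \in X -> matchings strip_adj us X = 0%N.
  by move=> H xX; apply: (matchings_isolated xX) => u /H; rewrite /strip_adj; lia.
have usfar D' u : u \in [seq j <- range (lo + 1) hi | D' j] -> lo < u.
  by rewrite mem_filter mem_range; lia.
have P0' pre := P0 (rcons pre (y lo)).
have P1' pre := P1 pre.
rewrite (_ : lo + 1 - 1 = lo) in P1'; last by lia.
pose F0 us pre X Y := (matchings strip_adj us X)%:R * ldet (pre ++ map y Y ++ post).
pose F1 us pre X Y := (matchings strip_adj us (lo - 1 :: X))%:R * ldet (pre ++ map y Y ++ post).
case Dlo : (D lo) => /=; split=> pre.
- rewrite (sumE (F0 [seq j <- range (lo + 1) hi | ~~ D j] pre)) /F0 P1' /= glo ldetD [LHS]addrC;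
  congr (_ + _).
  have := P0' pre; rewrite cat_rcons => <-.
  by apply: eq_bigr => p _; rewrite cat_rcons.
(* A particle arrives from below at a height where another one enters: the down triangle at [lo - 1]
   has no partner, and the determinant has two rows [g lo]. *)
- rewrite (sumE (F1 [seq j <- range (lo + 1) hi | ~~ D j] pre)) /F1 !big1 ?addr0 ?(ldet_dup _ _
  [::]) // => p _.
    by rewrite (@iso _ (lo - 1)) ?mul0r ?inE ?eqxx // => u /usfar; lia.
  by rewrite (@iso _ (lo - 1)) ?mul0r ?inE ?eqxx // => u /usfar; lia.
- rewrite (sumE (F0 (lo :: [seq j <- range (lo + 1) hi | ~~ D j]) pre)) /F0 [X in _ + X]big_seq
  [X in _ + X]big1 ?addr0; last first.
    by move=> p /far Hp; rewrite matchings_far // mul0r.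
  rewrite -P0 !big_seq; apply: eq_bigr => p /far Hp.
  by rewrite matchings_near // /strip_adj eqxx.
- rewrite (sumE (F1 (lo :: [seq j <- range (lo + 1) hi | ~~ D j]) pre)) /F1 glo ldetD
  [LHS]addrC; congr (_ + _); last first.
    rewrite -P1' !big_seq; apply: eq_bigr => p /far Hp.
    rewrite matchings_near2 // (@iso _ (lo - 1) (lo - 1 :: p.1)) ?addn0 ?inE ?eqxx // => u
      /usfar; lia.
  have := P0' pre; rewrite cat_rcons => <-.
  rewrite !big_seq; apply: eq_bigr => p /far Hp.
  by rewrite matchings_near ?cat_rcons // /strip_adj eqxx orbT.
Qed.
End Chain.

(** * Transfer along vertical strips *)

(* A strip between two consecutive vertical lines, given by the heights of its up
   triangles and of its down triangles. *)
Definition strip : Type := (seq int * seq int)%type.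

(* Tilings of the consecutive strips [l] when the up triangles at the heights [S] of the
   first line are covered by lozenges coming from the left. *)
Fixpoint transfer (l : seq strip) (S : seq int) : nat :=
  if l is (U, W) :: l' then
    if all (mem U) S then
      (\sum_(p <- splits W) matchings strip_adj [seq j <- U | j \notin S] p.1 * transfer l' p.2)%N
    else 0%N
  else nilp S.

Definition up (k v j : int) : tri := (true, k, v + j).
Definition dn (k v j : int) : tri := (false, k, v + j).

Fixpoint strip_ups (k v : int) (l : seq strip) : seq tri :=
  if l is (U, _) :: l' then map (up k v) U ++ strip_ups (k + 1) v l' else [::].
Fixpoint strip_downs (k v : int) (l : seq strip) : seq tri :=
  if l is (_, W) :: l' then map (dn k v) W ++ strip_downs (k + 1) v l' else [::].

Lemma up_inj k v : injective (up k v).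
Proof. by move=> x y [] /addrI. Qed.
Lemma dn_inj k v : injective (dn k v).
Proof. by move=> x y [] /addrI. Qed.

Lemma strip_ups_ge k v l t : t \in strip_ups k v l -> t.1.1 /\ k <= t.1.2.
Proof.
elim: l k => //= -[U W] l IH k; rewrite mem_cat => /orP[/mapP[j _ ->]|/IH [-> ?]] //=.
by split => //; lia.
Qed.

Lemma strip_downs_ge k v l t : t \in strip_downs k v l -> ~~ t.1.1 /\ k <= t.1.2.
Proof.
elim: l k => //= -[U W] l IH k; rewrite mem_cat => /orP[/mapP[j _ ->]|/IH [-> ?]] //=.
by split => //; lia.
Qed.

(** Among up triangles in columns at least [k], a down triangle of column [k - 1] has a single
    possible neighbour, the one to its right at the same height, so its lozenge is forced. *)
Lemma matchings_remove k v us ws S : uniq us -> uniq S ->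
  (forall u, u \in us -> u.1.1 && (k <= u.1.2)) ->
  matchings adj us (map (dn (k - 1) v) S ++ ws)
  = if all (fun s => up k v s \in us) S
    then matchings adj [seq u <- us | u \notin map (up k v) S] ws else 0%N.
Proof.
elim: S us => [|s S IH] us uu; first by move=> _ _ /=;
  rewrite (@eq_filter _ _ predT) ?filter_predT.
rewrite [uniq _]/= => /andP[sS uS] Hk; rewrite map_cons cat_cons matchings_cons_r /= picks_uniq
  // big_map /=.
have adjs u : u \in us -> adj u (dn (k - 1) v s) = (u == up k v s).
  by case: u => [[b i] j] /Hk /=; rewrite adjE !xpair_eqE; lia.
rewrite big_seq_cond.
have Hc u : (u \in us) && adj u (dn (k - 1) v s) = (u == up k v s) && (up k v s \in us).
  case: eqP => [->|/eqP ne]; first by case: (boolP (_ \in us)) => // H; rewrite adjs ?eqxx.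
  by case: (boolP (u \in us)) => // H; rewrite adjs // (negbTE ne).
rewrite (eq_bigl _ _ Hc) /=.
case: (boolP (up k v s \in us)) => sU /=; last by rewrite big1 // => u; rewrite andbF.
under eq_bigl do rewrite andbT.
rewrite -big_filter (_ : [seq u <- us | _] = [:: up k v s]); last first.
  exact: (filter_pred1_uniq uu).
rewrite big_cons big_nil addn0 IH ?rem_uniq //; last first.
  by move=> u /(mem_subseq (rem_subseq _ _))/Hk.
have -> : all (fun t => up k v t \in rem (up k v s) us) S = all (fun t => up k v t \in us) S.
  apply: eq_in_all => t tS; rewrite mem_rem_uniq // inE.
  by case: eqP => // /up_inj ts; rewrite -ts tS in sS.
rewrite rem_filter // -filter_predI; case: ifP => // _; congr matchings.
by apply: eq_filter => u /=; rewrite in_cons negb_or andbC.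
Qed.

Lemma matchings_strip k v (U S X : seq int) : uniq U -> uniq S ->
  matchings adj (map (up k v) U) (map (dn (k - 1) v) S ++ map (dn k v) X)
  = if all (mem U) S then matchings strip_adj [seq j <- U | j \notin S] X else 0%N.
Proof.
move=> uU uS; rewrite matchings_remove ?(map_inj_uniq (@up_inj k v)) //; last first.
  by move=> u /mapP[j _ ->] /=.
have -> : all (fun s => up k v s \in map (up k v) U) S = all (mem U) S.
  by apply: eq_all => s; rewrite /= (mem_map (@up_inj k v)).
case: ifP => // _; rewrite filter_map.
rewrite (eq_filter (a2 := fun j => j \notin S)); last first.
  by move=> j; rewrite /= (mem_map (@up_inj k v)).
by apply: matchings_map => u w; rewrite adjE /strip_adj /=; clear; lia.
Qed.

Definition wf (l : seq strip) := all (fun s : strip => uniq s.1 && uniq s.2) l.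

Lemma matchings_strips l k v S : wf l -> uniq S ->
  matchings adj (strip_ups k v l) (map (dn (k - 1) v) S ++ strip_downs k v l) = transfer l S.
Proof.
elim: l k S => [|[U W] l IH] k S /=; first by case: S.
case/andP=> /andP[uU uW] wl uS; rewrite matchings_cat; last 2 first.
- move=> [[b i] j] w /strip_ups_ge[_ /= ki] /mapP[s _ ->].
  by rewrite adjE; lia.
- move=> u [[b i] j] /mapP[s _ ->] /strip_downs_ge[_ /= ki].
  by rewrite adjE; lia.
rewrite splits_map big_map; case: ifP => HS; last first.
  by rewrite big1 // => p _; rewrite matchings_strip // HS.
rewrite big_seq [RHS]big_seq; apply: eq_bigr => p /splits_subseq_r Hp.
by rewrite matchings_strip // HS -(IH (k + 1)) ?(subseq_uniq Hp) // addrK.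
Qed.

(** * Summation over the integers and counting strip by strip *)

Lemma int_constant (V : Type) (f : int -> V) : (forall s, f s = f (s + 1)) -> forall s t, f s =
  f t.
Proof.
move=> H; have Hn s (n : nat) : f s = f (s + n%:Z).
  elim: n => [|n ->]; first by rewrite addr0.
  by rewrite H; congr f; lia.
move=> s t; have [st|ts] := leP s t.
  by rewrite (Hn s `|t - s|%N); congr f; lia.
by rewrite (Hn t `|s - t|%N); congr f; lia.
Qed.

Lemma antidiff (V : zmodType) (h : int -> V) s0 :
  exists g, (forall s, g s = h s + g (s + 1)) /\ g s0 = 0.
Proof.
pose G (s : int) := match s with
  | Posz k => - \sum_(i < k) h (i : nat)%:Z
  | Negz k => \sum_(i < k.+1) h (- (i : nat).+1%:Z) end.
have GE s : G s = h s + G (s + 1).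
  case: s => [k|[|k]].
  - by rewrite -[Posz k + 1]/(Posz (k + 1)) addn1 /= big_ord_recr /= opprD addrCA subrr addr0.
  - by rewrite /= big_ord1 big_ord0 oppr0 addr0 NegzE.
  - rewrite (_ : Negz k.+1 + 1 = Negz k); last by lia.
    by rewrite /= big_ord_recr /= addrC NegzE.
exists (fun s => G s - G s0); split=> [s|]; last by rewrite subrr.
by rewrite addrA -GE.
Qed.

Lemma filter_in_subseq (T : eqType) (s t : seq T) : uniq s -> subseq t s ->
  [seq x <- s | x \in t] = t.
Proof. by move=> us /(subseq_uniqP us) <-. Qed.

Section Transfer.
Context {R : comNzRingType}.

(** The strip has one up triangle more than down triangles. A fictitious down triangle at [hi], with
    row [g hi], reduces this to [chain]; coordinate [i], zero in every other row of the expanded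
    sum, forces a particle to leave there. *)
Lemma chain_exit n (i : 'I_n) (y g : int -> 'rV[R]_n) lo hi (D : pred int)
    (pre post : seq 'rV[R]_n) :
  lo <= hi -> (forall s, g s = y s + g (s + 1)) ->
  (forall s, y s 0 i = 0) -> (forall v : 'rV[R]_n, v \in pre ++ post -> v 0 i = 0) ->
  \sum_(p <- splits (range lo hi))
     (matchings strip_adj [seq j <- range lo (hi + 1) | ~~ D j] p.1)%:R
       * ldet (pre ++ map y p.2 ++ g hi :: post)
  = ldet (pre ++ map g [seq j <- range lo (hi + 1) | D j] ++ post).
Proof.
move=> lohi gE y0 pp0.
pose y' s := if s == hi then g hi else y s.
pose g' s := if s <= hi then g s else 0.
have := @chain R n y' g' lo (hi + 1) D pre post.
rewrite (_ : map g' _ = map g [seq j <- range lo (hi + 1) | D j]); last first.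
  apply/eq_in_map => s; rewrite mem_filter mem_range /g' => /and3P[_ _ sh].
  by rewrite ifT //; lia.
move <-; last 3 first.
- move=> s Hs; rewrite /g' /y'; have -> : s <= hi by lia.
  case: eqP => [->|nsh]; first by rewrite ifF ?addr0 //; lia.
  by rewrite ifT //; lia.
- by rewrite /g' ifF //; lia.
- by lia.
rewrite range_rcons //.
set us := [seq j <- _ | _].
pose F X Y := (matchings strip_adj us X)%:R * ldet (pre ++ map y' Y ++ post).
have sumE (L : seq int) : \sum_(p <- splits (L ++ [:: hi])) F p.1 p.2
    = \sum_(p <- splits L) F (p.1 ++ [:: hi]) p.2 + \sum_(p <- splits L) F p.1 (p.2 ++ [:: hi]).
  elim: L F => [|x L IH] F /=.
    by rewrite !big_cons !big_nil !addr0.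
  rewrite !big_cat !big_map /= (IH (fun X Y => F (x :: X) Y)) (IH (fun X Y => F X (x :: Y))).
  by rewrite addrACA.
rewrite sumE [X in X + _]big_seq [X in X + _]big1 ?add0r => [|p Hp]; last first.
  rewrite /F (@ldet_col0 _ _ i) ?mulr0 // => v; rewrite !mem_cat orbCA => /orP[|vpp]; last first.
    by apply: pp0; rewrite mem_cat.
  case/mapP=> t /(mem_subseq (splits_subseq_r Hp)); rewrite mem_range => Ht ->.
  by rewrite /y' ifF //; lia.
rewrite !big_seq; apply: eq_bigr => p Hp; rewrite /F map_cat /= {2}/y' eqxx -catA.
congr (_ * ldet (_ ++ _ ++ _)); apply/eq_in_map => t /(mem_subseq (splits_subseq_r Hp)).
by rewrite mem_range /y' => Ht; rewrite ifF //; lia.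
Qed.

(** The up triangles sit one unit higher than the down triangles, so particles move down. A
    fictitious up triangle at [lo], covered from the left, restores the setting of [chain_exit]; the
    extra coordinate then eliminates its row on one side and the exit row on the other. *)
Lemma chain_down n (y g : int -> 'rV[R]_n) lo hi (D : pred int) pre :
  lo <= hi -> (forall s, g (s + 1) = g s + y s) -> g lo = 0 ->
  \sum_(p <- splits (range lo hi))
     (matchings strip_adj [seq j <- range (lo + 1) (hi + 1) | ~~ D j] p.1)%:R * ldet (pre ++ map
       y p.2)
  = ldet (pre ++ map g [seq j <- range (lo + 1) (hi + 1) | D j]).
Proof.
move=> lohi gE glo.
pose y' s := row_mx (y s) (0 : 'rV[R]_1).
pose g' s := row_mx (- g s) (1 : 'rV[R]_1).
have lo1 : lo < hi + 1 by lia.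
have := @chain_exit (n + 1) (rshift n ord0) y' g' lo hi (fun j => (j == lo) || D j)
  (map (fun v => row_mx v 0) pre) [::].
rewrite (range_cons lo1) /= eqxx /=.
have Hf (P : pred int) : [seq j <- range (lo + 1) (hi + 1) | (j == lo) || P j]
    = [seq j <- range (lo + 1) (hi + 1) | P j].
  by apply: eq_in_filter => j; rewrite mem_range; case: eqP => //; lia.
have -> : [seq j <- range (lo + 1) (hi + 1) | ~~ ((j == lo) || D j)]
    = [seq j <- range (lo + 1) (hi + 1) | ~~ D j].
  by apply: eq_in_filter => j; rewrite mem_range; case: eqP => //; lia.
rewrite {}Hf !cats0 => Hc.
transitivity (ldet ([seq row_mx v 0 | v <- pre] ++
   g' lo :: [seq g' i | i <- [seq j <- range (lo + 1) (hi + 1) | D j]])).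
  rewrite -{}Hc //; last 3 first.
  - by move=> s; rewrite /g' /y' add_row_mx add0r gE opprD addrCA subrr addr0.
  - by move=> s; rewrite /y' row_mxEr mxE.
  - by move=> v /mapP[w _ ->]; rewrite row_mxEr mxE.
  apply: eq_bigr => p _; congr (_ * _).
  rewrite -[RHS](_ : ldet ([seq row_mx v 0 | v <- pre ++ map y p.2] ++ row_mx (- g hi) 1 :: map
    (fun v => row_mx v 0) [::]) = _).
    by rewrite ldet_border cats0.
  by rewrite map_cat -map_comp -catA.
have -> : [seq g' i | i <- [seq j <- range (lo + 1) (hi + 1) | D j]]
  = [seq g' lo + v | v <- [seq row_mx w 0 | w <- [seq - g j | j <- [seq j <- range (lo + 1) (hi
    + 1) | D j]]]].
  rewrite -!map_comp; apply: eq_map => j /=.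
  by rewrite /g' glo oppr0 add_row_mx add0r addr0.
rewrite ldet_translate_r ldet_border -map_comp.
by congr (ldet (_ ++ _)); apply: eq_map => j /=; rewrite opprK.
Qed.

(** The size of [D] is not prescribed: with a wrong number of heights there is no tiling, and [ldet]
    is 0 by convention. *)
Definition cnt1 (l : seq strip) lo hi n (phi : int -> 'rV[R]_n) :=
  forall D, subseq D (range lo hi) -> (transfer l D)%:R = ldet (map phi D) :> R.

Definition cnt2 (l : seq strip) lo x y hi n (phim phip : int -> 'rV[R]_n) :=
  forall D1 D2, subseq D1 (range lo x) -> subseq D2 (range y hi) ->
  (transfer l (D1 ++ D2))%:R = ldet (map phim D1 ++ map phip D2) :> R.

Lemma cnt_plain l lo hi n (phi g : int -> 'rV[R]_n) :
  lo <= hi -> (forall s, g s = phi s + g (s + 1)) -> cnt1 l lo hi phi ->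
  cnt1 ((range lo (hi + 1), range lo hi) :: l) lo (hi + 1) (fun s => row_mx (g s) (1 : 'rV[R]_1)).
Proof.
move=> lohi gE Hl D HD /=; rewrite ifT; last by apply/allP => j /(mem_subseq HD).
pose y s := row_mx (phi s) (0 : 'rV[R]_1).
have := @chain_exit _ (rshift n ord0) y (fun s => row_mx (g s) (1 : 'rV[R]_1)) lo hi (mem D)
  [::] [::].
rewrite !cats0 /= (filter_in_subseq (range_uniq _ _) HD) => <- //; last 2 first.
- by move=> s; rewrite add_row_mx add0r gE.
- by move=> s; rewrite row_mxEr mxE.
rewrite natr_sum !big_seq; apply: eq_bigr => p Hp; rewrite natrM; congr (_ * _).
rewrite Hl ?(splits_subseq_r Hp) //.
have := ldet_border (g hi) (map phi p.2) [::]; rewrite /= cats0 => <-.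
by rewrite -map_comp.
Qed.

Lemma transfer_cat2 U1 U2 W1 W2 l D1 D2 :
  uniq U1 -> uniq U2 -> subseq D1 U1 -> subseq D2 U2 ->
  (forall u w, u \in U1 -> w \in U2 -> u != w) ->
  (forall u w, u \in U1 -> w \in W2 -> u < w) ->
  (forall u w, u \in U2 -> w \in W1 -> w < u - 1) ->
  transfer ((U1 ++ U2, W1 ++ W2) :: l) (D1 ++ D2)
  = (\sum_(p <- splits W1) \sum_(q <- splits W2)
      (matchings strip_adj [seq j <- U1 | j \notin D1] p.1 * matchings strip_adj [seq j <- U2 |
        j \notin D2] q.1
       * transfer l (p.2 ++ q.2)))%N.
Proof.
move=> u1 u2 H1 H2 H12 HW2 HW1 /=; rewrite ifT; last first.
  by apply/allP => j; rewrite /= !mem_cat => /orP[/(mem_subseq H1)|/(mem_subseq H2)] ->;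
    rewrite ?orbT.
set us := [seq j <- _ | _].
rewrite (sum_splits_cat (fun X Y => matchings strip_adj us X * transfer l Y)%N).
rewrite !big_seq; apply: eq_bigr => p Hp; rewrite !big_seq; apply: eq_bigr => q Hq.
have sub1 x : x \in p.1 -> x \in W1 by move=> xp; rewrite (perm_mem (splits_perm Hp)) mem_cat xp.
have sub2 x : x \in q.1 -> x \in W2 by move=> xp; rewrite (perm_mem (splits_perm Hq)) mem_cat xp.
congr (_ * _)%N; rewrite /us filter_cat.
have -> : [seq j <- U1 | j \notin D1 ++ D2] = [seq j <- U1 | j \notin D1].
  apply: eq_in_filter => j jU; rewrite mem_cat; case: (boolP (j \in D2)); rewrite ?orbF //.
  by move=> /(mem_subseq H2)/(H12 _ _ jU); rewrite eqxx.
have -> : [seq j <- U2 | j \notin D1 ++ D2] = [seq j <- U2 | j \notin D2].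
  apply: eq_in_filter => j jU; rewrite mem_cat; case: (boolP (j \in D1)) => //.
  by move=> /(mem_subseq H1)/H12/(_ jU); rewrite eqxx.
rewrite -[p.1 ++ q.1]/(p.1 ++ [::] ++ q.1) matchings_cat /=.
- by rewrite big_cons big_nil addn0 cats0.
- move=> u w; rewrite mem_filter => /andP[_ uU] /sub1 wW; have := HW1 _ _ uU wW.
  by rewrite /strip_adj; lia.
- move=> u w; rewrite mem_filter => /andP[_ uU] /sub2 wW; have := HW2 _ _ uU wW.
  by rewrite /strip_adj; lia.
Qed.

(* On each side of the outer lobe one particle leaves, which accounts for the two new
   coordinates; the sign of [phip] makes up for the lower exit being in mid-list. *)
Lemma cnt_outer l lo x y hi n (phim phip gm gp : int -> 'rV[R]_n) :
  lo <= x -> x < y -> y <= hi ->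
  (forall s, gm s = phim s + gm (s + 1)) -> (forall s, gp s = - phip s + gp (s + 1)) ->
  cnt2 l lo x y hi phim phip ->
  cnt2 ((range lo (x + 1) ++ range y (hi + 1), range lo x ++ range y hi) :: l) lo (x + 1) y (hi
    + 1)
    (fun s => row_mx (row_mx (gm s) (1 : 'rV[R]_1)) (0 : 'rV[R]_1))
    (fun s => row_mx (row_mx (gp s) (0 : 'rV[R]_1)) (1 : 'rV[R]_1)).
Proof.
move=> lox xy yhi gmE gpE Hl D1 D2 H1 H2.
rewrite transfer_cat2 ?range_uniq //; try by (move=> u w; rewrite !mem_range; lia).
pose ym s := row_mx (row_mx (phim s) (0 : 'rV[R]_1)) (0 : 'rV[R]_1).
pose yp s := row_mx (row_mx (- phip s) (0 : 'rV[R]_1)) (0 : 'rV[R]_1).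
pose Gm s := row_mx (row_mx (gm s) (1 : 'rV[R]_1)) (0 : 'rV[R]_1).
pose Gp s := row_mx (row_mx (gp s) (0 : 'rV[R]_1)) (1 : 'rV[R]_1).
rewrite -/Gm -/Gp.
have Cm post := @chain_exit _ (lshift 1 (rshift n ord0)) ym Gm lo x (mem D1) [::] post.
have Cp pre := @chain_exit _ (rshift (n + 1) ord0) yp Gp y hi (mem D2) pre [::].
rewrite !(filter_in_subseq (range_uniq _ _)) // /= in Cm Cp.
rewrite -Cm //; first last.
- by move=> v /mapP[s _ ->]; rewrite /Gp row_mxEl row_mxEr mxE.
- by move=> s; rewrite /ym row_mxEl row_mxEr mxE.
- by move=> s; rewrite /Gm /ym !add_row_mx !add0r -gmE.
rewrite natr_sum !big_seq; apply: eq_bigr => p Hp.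
have := Cp (map ym p.2 ++ [:: Gm x]); rewrite !cats0 -!catA /= => <- //; first last.
- move=> v; rewrite mem_cat inE => /orP[/mapP[s _ ->]|/eqP->];
  by rewrite /ym /Gm row_mxEr mxE.
- by move=> s; rewrite /yp row_mxEr mxE.
- by move=> s; rewrite /Gp /yp !add_row_mx !add0r -gpE.
rewrite natr_sum mulr_sumr !big_seq; apply: eq_bigr => q Hq.
rewrite !natrM -!mulrA; congr (_ * (_ * _)).
rewrite Hl ?(splits_subseq_r Hp) ?(splits_subseq_r Hq) //.
have := ldet_border (gm x) (map phim p.2) (map (fun s => - phip s) q.2).
have -> : map -%R (map (fun s => - phip s) q.2) = map phip q.2.
  by rewrite -map_comp; apply: eq_map => s /=; rewrite opprK.
move <-; have := ldet_border (row_mx (gp hi) 0) ([seq row_mx v (0 : 'rV[R]_1) | v <- map phim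
  p.2] ++
   row_mx (gm x) 1 :: [seq row_mx v 0 | v <- map (fun s => - phip s) q.2]) [::].
rewrite /= cats0 => <-; congr ldet.
by rewrite map_cat /= -!map_comp -!catA.
Qed.

(** On each side of the inner lobe there are as many up as down triangles, so the dimension stays
    the same. Particles move towards the lobe, up from below it and down from above it, which fixes
    the constants of summation by [gm 0 = 0] and [gp r = 0]. *)
Lemma cnt_inner l lo r hi n (phim phip gm gp : int -> 'rV[R]_n) :
  lo <= 0 -> 0 <= r -> r <= hi ->
  (forall s, gm s = phim s + gm (s + 1)) -> gm 0 = 0 ->
  (forall s, gp s = - phip s + gp (s + 1)) -> gp r = 0 ->
  cnt2 l lo 0 r hi phim phip ->
  cnt2 ((range lo 0 ++ range (r + 1) (hi + 1), range lo 0 ++ range r hi) :: l) lo 0 (r + 1) (hi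
    + 1) gm gp.
Proof.
move=> lo0 r0 rhi gmE gm0 gpE gpr Hl D1 D2 H1 H2.
rewrite transfer_cat2 ?range_uniq //; try by (move=> u w; rewrite !mem_range; lia).
have Cm post := @chain _ _ phim gm lo 0 (mem D1) [::] post.
have Cp pre := @chain_down _ phip gp r hi (mem D2) pre.
rewrite !(filter_in_subseq (range_uniq _ _)) // /= in Cm Cp.
rewrite -Cm // natr_sum !big_seq; apply: eq_bigr => p Hp.
rewrite -Cp //; last by move=> s; rewrite (gpE s) addrAC addNr add0r.
rewrite natr_sum mulr_sumr !big_seq; apply: eq_bigr => q Hq.
by rewrite !natrM -!mulrA Hl ?(splits_subseq_r Hp) ?(splits_subseq_r Hq).
Qed.
End Transfer.

(** * Multiplication by a linear factor *)

Section Eigen.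
Context {R : comNzRingType}.

(** The left side is a difference of consecutive values of (A - s) [phi s]. The equation thus places
    (A - s) V among the functions whose difference lies in V, the space of the next plain strip. *)
Definition eig n (phi : int -> 'rV[R]_n) (A : int) (B : 'M[R]_n) :=
  forall s, (A - s)%:~R *: phi s - (A - s - 1)%:~R *: phi (s + 1) = phi s *m B.

Lemma eig_const n (phi g : int -> 'rV[R]_n) A B (a : R) s0 :
  eig phi A B -> (forall s, g s = a *: phi s + g (s + 1)) -> g s0 = 0 ->
  forall s, (a * (A - s)%:~R) *: phi s = g s *m B + (a * (A - s0)%:~R) *: phi s0.
Proof.
move=> HB gE g0 s.
pose f s := (a * (A - s)%:~R) *: phi s - g s *m B.
have fc : forall s, f s = f (s + 1).
  move=> t; apply/eqP; rewrite -subr_eq0 /f (gE t) mulmxDl -scalemxAl -HB.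
  rewrite (_ : A - (t + 1) = A - t - 1); last by ring.
  apply/eqP/rowP => i; rewrite !mxE; ring.
have := int_constant fc s s0; rewrite /f g0 mul0mx subr0 => <-.
by rewrite [RHS]addrC subrK.
Qed.

(** The last term does not depend on [s]; how it is absorbed is what distinguishes the plain, outer
    and inner strips. *)
Lemma eig_step n (phi g : int -> 'rV[R]_n) A B (a : R) s0 :
  eig phi A B -> (forall s, g s = a *: phi s + g (s + 1)) -> g s0 = 0 ->
  forall s, (A + 1 - s)%:~R *: g s - (A + 1 - s - 1)%:~R *: g (s + 1)
            = g s *m (B + 1%:M) + (a * (A - s0)%:~R) *: phi s0.
Proof.
move=> HB gE g0 s; rewrite mulmxDr mulmx1 [RHS]addrAC -(eig_const HB gE g0 s).
have -> : g (s + 1) = g s - a *: phi s by rewrite (gE s) addrAC subrr add0r.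
rewrite (_ : A + 1 - s = A - s + 1); last by ring.
by apply/rowP => i; rewrite !mxE rmorphD /= rmorph1 addrK; ring.
Qed.

Lemma scalar_mxD n (a b : R) : (a + b)%:M = a%:M + b%:M :> 'M_n.
Proof. exact: raddfD. Qed.

Lemma intr_pred (t : int) : t%:~R - (t - 1)%:~R = 1 :> R.
Proof. by rewrite -rmorphB /= opprB addrC subrK. Qed.

(* [phim] and [phip] are the functions below and above the hole at [C]; [chi] records the
   determinants needed after [B] has been shifted by further strips. *)
Definition sys n (chi : R -> R) A (phim phip : int -> 'rV[R]_n) :=
  exists B, [/\ eig phim A B, eig phip A B & forall x, \det (B + x%:M) = chi x].

Lemma sys_plain n chi A (phi g : int -> 'rV[R]_n) s0 :
  sys chi A phi phi -> (forall s, g s = phi s + g (s + 1)) -> g s0 = 0 ->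
  let psi s := row_mx (g s) (1 : 'rV[R]_1) in
  sys (fun x => (x + 1) * chi (x + 1)) (A + 1) psi psi.
Proof.
case=> B [HB _ chiE] gE g0 psi.
have gE' s : g s = 1 *: phi s + g (s + 1) by rewrite scale1r.
pose B' := block_mx (B + 1%:M) 0 ((1 * (A - s0)%:~R) *: phi s0) (1%:M : 'M_1).
have HB' : eig psi (A + 1) B'.
  move=> s; rewrite /psi !scale_row_mx opp_row_mx add_row_mx (eig_step HB gE' g0).
  rewrite /B' mul_row_block mulmx0 add0r mulmx1 mul1mx; congr row_mx.
  rewrite -scalerBl -[RHS]scale1r; congr (_ *: _).
  exact: intr_pred.
exists B'; split=> // x.
rewrite /B' scalar_mx_block add_block_mx addr0 det_lblock -addrA -scalar_mxD chiE.
by rewrite -scalar_mxD det_scalar1 !(addrC 1) mulrC.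
Qed.

Lemma sys_outer n chi A (phim phip gm gp : int -> 'rV[R]_n) s0 s1 :
  sys chi A phim phip ->
  (forall s, gm s = phim s + gm (s + 1)) -> gm s0 = 0 ->
  (forall s, gp s = - phip s + gp (s + 1)) -> gp s1 = 0 ->
  sys (fun x => (x + 1) ^+ 2 * chi (x + 1)) (A + 1)
    (fun s => row_mx (row_mx (gm s) (1 : 'rV[R]_1)) (0 : 'rV[R]_1))
    (fun s => row_mx (row_mx (gp s) (0 : 'rV[R]_1)) (1 : 'rV[R]_1)).
Proof.
case=> B [Hm Hp chiE] gmE gm0 gpE gp0.
have gmE' s : gm s = 1 *: phim s + gm (s + 1) by rewrite scale1r.
have gpE' s : gp s = (- 1) *: phip s + gp (s + 1) by rewrite scaleN1r.
(* The constants of summation below and above the hole are different. Each has its own new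
   coordinate, so that one matrix serves both families. *)
pose B1 := block_mx (B + 1%:M) 0 ((1 * (A - s0)%:~R) *: phim s0) (1%:M : 'M_1).
pose B2 := block_mx B1 0 (row_mx (((-1) * (A - s1)%:~R) *: phip s1) 0) (1%:M : 'M_1).
exists B2; split=> [s|s|x].
- rewrite !scale_row_mx !opp_row_mx !add_row_mx (eig_step Hm gmE' gm0).
  rewrite /B2 /B1 !mul_row_block !mulmx0 !mul0mx !addr0 !add0r !mulmx1 !mul1mx.
  rewrite !scaler0 subr0; congr (row_mx (row_mx _ _) _).
  rewrite -scalerBl -[RHS]scale1r; congr (_ *: _).
  exact: intr_pred.
- rewrite !scale_row_mx !opp_row_mx !add_row_mx (eig_step Hp gpE' gp0).
  rewrite /B2 /B1 !mul_row_block !mulmx0 !mul0mx !addr0 !add0r !mulmx1 !mul1mx.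
  rewrite !scaler0 subr0 add_row_mx addr0; congr (row_mx (row_mx _ _) _).
  rewrite -scalerBl -[RHS]scale1r; congr (_ *: _).
  exact: intr_pred.
rewrite /B2 scalar_mx_block add_block_mx addr0 det_lblock.
rewrite /B1 scalar_mx_block add_block_mx addr0 det_lblock -addrA -scalar_mxD chiE.
rewrite -scalar_mxD det_scalar1 !(addrC 1) expr2; ring.
Qed.

(** There is no new coordinate to take up the constants of summation, so the two hypotheses at [s0]
    and [s1] require them to be zero. *)
Lemma sys_inner n chi A (phim phip gm gp : int -> 'rV[R]_n) s0 s1 :
  sys chi A phim phip ->
  (forall s, gm s = phim s + gm (s + 1)) -> gm s0 = 0 ->
  (forall s, gp s = - phip s + gp (s + 1)) -> gp s1 = 0 ->
  (A - s0)%:~R *: phim s0 = 0 -> (A - s1)%:~R *: phip s1 = 0 ->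
  sys (fun x => chi (x + 1)) (A + 1) gm gp.
Proof.
case=> B [Hm Hp chiE] gmE gm0 gpE gp0 km kp.
have gmE' s : gm s = 1 *: phim s + gm (s + 1) by rewrite scale1r.
have gpE' s : gp s = (- 1) *: phip s + gp (s + 1) by rewrite scaleN1r.
exists (B + 1%:M); split=> [s|s|x].
- by rewrite (eig_step Hm gmE' gm0) -scalerA km scaler0 addr0.
- by rewrite (eig_step Hp gpE' gp0) -scalerA kp scaler0 addr0.
- by rewrite -addrA -scalar_mxD chiE addrC.
Qed.

(* Multiplication by [A - s] maps the span of [phi] onto the functions vanishing at [A] in
   the span of the next plain system. *)
Lemma ldet_insert n chi A (phi g : int -> 'rV[R]_n) s0 l1 l2 :
  sys chi A phi phi -> (forall s, g s = phi s + g (s + 1)) -> g s0 = 0 ->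
  let psi s := row_mx (g s) (1 : 'rV[R]_1) in
  ldet (map psi (l1 ++ A :: l2)) * chi 0
  = (\prod_(s <- l1) (A - s)%:~R) * (\prod_(s <- l2) (s - A)%:~R) * ldet (map phi (l1 ++ l2)).
Proof.
case=> B [HB _ chiE] gE g0 psi.
have gE' s : g s = 1 *: phi s + g (s + 1) by rewrite scale1r.
have kE := eig_const HB gE' g0.
(* By [eig_const], [P] sends [psi s] to the row ((A - s) [phi s], 1), hence the row of [A] to (0,
   1). Subtracting that row from the others and expanding along the last column leaves the multiples
   of the [phi s], negated beyond [A]. *)
pose P := block_mx B 0 ((1 * (A - s0)%:~R) *: phi s0) (1%:M : 'M_1).
have -> : chi 0 = \det P by rewrite /P det_lblock det1 mulr1 -chiE raddf0 addr0.
rewrite -ldet_mul -map_comp.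
have [x xE] : exists x, forall s, x s = (A - s)%:~R *: phi s by eexists.
have psiP s : psi s *m P = row_mx 0 1 + row_mx (x s) 0.
  rewrite /psi /P mul_row_block mulmx0 add0r mulmx1 mul1mx add_row_mx add0r addr0.
  by congr row_mx; rewrite -kE mul1r xE.
rewrite (eq_map (g := fun s => row_mx 0 1 + row_mx (x s) 0)); last exact: psiP.
have xA : x A = 0 by rewrite xE subrr scale0r.
rewrite [map _ (l1 ++ A :: l2)]map_cat /= xA row_mx0 addr0.
rewrite (map_comp (fun v => row_mx 0 1 + v) (fun s => row_mx (x s) 0) l1).
rewrite (map_comp (fun v => row_mx 0 1 + v) (fun s => row_mx (x s) 0) l2).
rewrite ldet_translate (map_comp (fun v => row_mx v 0) x l1).
rewrite (map_comp (fun v => row_mx v 0) x l2) ldet_border.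
have -> : map -%R (map x l2) = [seq (s - A)%:~R *: phi s | s <- l2].
  by rewrite -map_comp; apply: eq_map => s; rewrite /= xE -scaleNr -rmorphN /= opprB.
rewrite (eq_map xE).
have -> := ldet_scale (fun s => (A - s)%:~R) phi l1 [::].
rewrite /= -[[seq (s - A)%:~R *: phi s | s <- l2]]cats0 ldet_scale cats0 -map_cat.
by rewrite mulrA.
Qed.
End Eigen.

(* Strips are prepended from right to left, so the last one prepended is the leftmost.
   Heights are relative to [C]: the outer lobe of side [c] occupies the heights [- c, 0) on
   its right side, the inner lobe of side [r] the heights [0, r) on its left side. *)
Fixpoint plain_strips (lo hi : int) (l : seq strip) (e : nat) : seq strip :=
  if e is e'.+1 then (range lo (hi + e'%:Z + 1), range lo (hi + e'%:Z)) :: plain_strips lo hi l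
    e' else l.

Fixpoint outer_strips (lo hi : int) (l : seq strip) (c q : nat) : seq strip :=
  if q is q'.+1 then
    (range lo (q'%:Z - c%:Z + 1) ++ range 0 (hi + q'%:Z + 1),
     range lo (q'%:Z - c%:Z) ++ range 0 (hi + q'%:Z)) :: outer_strips lo hi l c q'
  else l.

Fixpoint inner_strips (lo hi : int) (l : seq strip) (r : nat) : seq strip :=
  if r is r'.+1 then
    (range lo 0 ++ range (r'%:Z + 1) (hi + r'%:Z + 1),
     range lo 0 ++ range r'%:Z (hi + r'%:Z)) :: inner_strips lo hi l r'
  else l.

(** * Determinants for a half with a bowtie *)

Section Systems.
Context {R : comNzRingType}.

Definition rising (n : nat) (x : R) : R := \prod_(i < n) (x + i.+1%:R).

Lemma risingS n x : rising n.+1 x = (x + 1) * rising n (x + 1).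
Proof.
rewrite /rising big_ord_recl; congr (_ * _); apply: eq_bigr => i _.
by rewrite -addrA nat1r.
Qed.

Lemma sys_ext n chi chi' A (phim phip : int -> 'rV[R]_n) :
  chi =1 chi' -> sys chi A phim phip -> sys chi' A phim phip.
Proof. by move=> E [B [? ? H]]; exists B; split=> // x; rewrite H. Qed.

Lemma plain_iter n chi A (phi : int -> 'rV[R]_n) e : sys chi A phi phi ->
  exists n' (phi' : int -> 'rV[R]_n'),
    sys (fun x => rising e x * chi (x + e%:R)) (A + e%:Z) phi' phi' /\
    forall l lo hi, lo <= hi -> cnt1 l lo hi phi -> cnt1 (plain_strips lo hi l e) lo (hi + e%:Z)
      phi'.
Proof.
move=> Hs; elim: e => [|e [n' [phi' [IHs IHc]]]].
  exists n, phi; rewrite addr0; split=> [|l lo hi _]; last by rewrite addr0.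
  by apply: sys_ext Hs => x; rewrite /rising big_ord0 mul1r addr0.
have [g [gE g0]] := antidiff phi' 0.
have := sys_plain IHs gE g0; set psi := fun _ => _ => Hpsi.
exists _, psi; split.
  rewrite (_ : A + _ = A + e%:Z + 1); last by rewrite -addn1 PoszD addrA.
  by apply: sys_ext Hpsi => x; rewrite risingS mulrA -addrA nat1r.
move=> l lo hi lohi Hl /=.
rewrite (_ : hi + e.+1%:Z = hi + e%:Z + 1); last by rewrite -addn1 PoszD addrA.
by apply: cnt_plain gE (IHc _ _ _ lohi Hl); lia.
Qed.

Lemma outer_iter n chi A (phi : int -> 'rV[R]_n) c : sys chi A phi phi ->
  exists n' (phim phip : int -> 'rV[R]_n'),
    sys (fun x => rising c x ^+ 2 * chi (x + c%:R)) (A + c%:Z) phim phip /\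
    forall l lo hi, lo <= - c%:Z -> 0 <= hi -> cnt1 l lo hi phi ->
      cnt2 (outer_strips lo hi l c c) lo 0 0 (hi + c%:Z) phim phip.
Proof.
move=> Hs.
suff H q : (q <= c)%N -> exists n' (phim phip : int -> 'rV[R]_n'),
    sys (fun x => rising q x ^+ 2 * chi (x + q%:R)) (A + q%:Z) phim phip /\
    forall l lo hi, lo <= - c%:Z -> 0 <= hi -> cnt1 l lo hi phi ->
      cnt2 (outer_strips lo hi l c q) lo (q%:Z - c%:Z) 0 (hi + q%:Z) phim phip.
  by have := H c (leqnn c); rewrite subrr.
elim: q => [_|q IH qc].
  exists n, phi, phi; rewrite addr0; split.
    by apply: sys_ext Hs => x; rewrite /rising big_ord0 expr1n mul1r addr0.
  (* At the right side of the outer lobe nothing has changed yet, except that no particle may sit at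
     the heights [- c, 0). *)
  move=> l lo hi loc hi0 Hl D1 D2 H1 H2; rewrite -map_cat; apply: Hl.
  rewrite (@range_cat lo (0 - c%:Z) hi); [|by lia|by lia].
  apply: cat_subseq => //; rewrite (@range_cat _ 0 hi); [|by lia|by lia].
  by apply: subseq_trans (suffix_subseq _ _); rewrite addr0 in H2.
have [n' [phim [phip [IHs IHc]]]] := IH (ltnW qc).
have [gm [gmE gm0]] := antidiff phim 0.
have [gp [gpE gp0]] := antidiff (fun s => - phip s) 0.
have := sys_outer IHs gmE gm0 gpE gp0.
set ch := fun _ => _; set psim := fun _ => _; set psip := fun _ => _ => Hpsi.
exists _, psim, psip; split.
  rewrite (_ : A + _ = A + q%:Z + 1); last by rewrite -addn1 PoszD addrA.
  by apply: sys_ext Hpsi => x; rewrite /ch risingS exprMn mulrA -addrA nat1r.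
move=> l lo hi loc hi0 Hl /=.
rewrite (_ : hi + q.+1%:Z = hi + q%:Z + 1); last by rewrite -addn1 PoszD addrA.
rewrite (_ : q.+1%:Z - c%:Z = q%:Z - c%:Z + 1); last by lia.
by apply: cnt_outer gmE gpE (IHc _ _ _ loc hi0 Hl); lia.
Qed.

(** After [r] strips the height A equals [r], the upper end of the lobe, which kills the constant
    above it. The constant below has the factor A times the value at 0: the value is 0 once [r > 0],
    because the functions vanish on the lobe, and A is 0 when [r = 0]. *)
Lemma inner_iter n chi (phim phip : int -> 'rV[R]_n) r : sys chi 0 phim phip ->
  exists (psim psip : int -> 'rV[R]_n),
    [/\ sys (fun x => chi (x + r%:R)) r%:Z psim psip,
      forall s, 0 <= s < r%:Z -> psim s = 0 /\ psip s = 0 &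
      forall l lo hi, lo <= 0 -> 0 <= hi -> cnt2 l lo 0 0 hi phim phip ->
      cnt2 (inner_strips lo hi l r) lo 0 r%:Z (hi + r%:Z) psim psip].
Proof.
move=> Hs; elim: r => [|r [fm [fp [IHs IH0 IHc]]]].
  exists phim, phip; split=> [|s|l lo hi _ _]; [|by lia|by rewrite addr0].
  by apply: sys_ext Hs => x; rewrite addr0.
have [gm [gmE gm0]] := antidiff fm 0.
have [gp [gpE gpr]] := antidiff (fun s => - fp s) r%:Z.
have zm (k : nat) : (k <= r)%N -> gm k%:Z = 0.
  elim: k => // k IHk kr; have := gmE k%:Z; rewrite IHk; last exact: ltnW.
  have [-> _] := IH0 k%:Z kr; rewrite add0r => ->.
  by congr gm; lia.
have zp (k : nat) : (k <= r)%N -> gp (r - k)%N%:Z = 0.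
  elim: k => [|k IHk] kr; first by rewrite subn0.
  have -> : (r - k.+1)%N%:Z = r%:Z - k.+1%:Z by lia.
  have [|_ fp0] := IH0 (r%:Z - k.+1%:Z); first by lia.
  rewrite gpE fp0 oppr0 add0r (_ : _ + 1 = (r - k)%N%:Z); first exact/IHk/ltnW.
  by lia.
have H0 : (r%:Z - 0)%:~R *: fm 0 = 0.
  case: (posnP r) => [->|r0]; first by rewrite subrr scale0r.
  by have [|-> _] := IH0 0; [lia | rewrite scaler0].
exists gm, gp; split.
- have := sys_inner IHs gmE gm0 gpE gpr H0; rewrite subrr scale0r => /(_ erefl).
  rewrite -[r.+1]addn1 PoszD; apply: sys_ext => x.
  by rewrite -addrA nat1r addn1.
- move=> s Hs'; have -> : s = `|s|%N by lia.
  split; first by apply: zm; lia.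
  by have := zp (r - `|s|)%N; rewrite subKn; [apply; lia | lia].
- move=> l lo hi lo0 hi0 Hl /=.
  rewrite (_ : hi + r.+1%:Z = hi + r%:Z + 1); last by rewrite -addn1 PoszD addrA.
  rewrite -[in r.+1%:Z]addn1 PoszD.
  by apply: cnt_inner gmE gm0 gpE gpr (IHc _ _ _ lo0 hi0 Hl); lia.
Qed.

Lemma ldet_mem0 n (l : seq 'rV[R]_n) : 0 \in l -> ldet l = 0.
Proof. by case/splitPr => l1 l2; rewrite ldet0. Qed.

(** A height on the lobe has no up triangle in the leftmost inner strip and gives a zero row, so
    both sides vanish. Every other configuration splits into its parts below and above the lobe. *)
Lemma merge_cnt n (phim phip : int -> 'rV[R]_n) (r : nat) :
  (forall s, 0 <= s < r%:Z -> phim s = 0 /\ phip s = 0) ->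
  forall l lo hi, lo <= 0 -> 0 <= hi ->
  cnt2 (inner_strips lo hi l r) lo 0 r%:Z (hi + r%:Z) phim phip ->
  cnt1 (inner_strips lo hi l r) lo (hi + r%:Z) (fun s => if s < r%:Z then phim s else phip s).
Proof.
move=> H0 l lo hi lo0 hi0 Hl D HD.
set phi := fun _ => _.
case: (boolP (has (fun s => 0 <= s < r%:Z) D)) => [/hasP[s sD Hs]|/hasPn Hn].
  rewrite ldet_mem0; last first.
    apply/mapP; exists s => //; rewrite /phi ifT; last by lia.
    by case: (H0 _ Hs).
  case: r Hs {H0 Hl HD phi} => [|r] Hs; first by lia.
  rewrite /= ifF //; apply/negbTE/allPn; exists s => //=.
  by rewrite mem_cat !mem_range; lia.
have ED : D = [seq s <- range lo 0 | s \in D] ++ [seq s <- range r%:Z (hi + r%:Z) | s \in D].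
  rewrite -[LHS](filter_in_subseq (range_uniq _ _) HD).
  rewrite (@range_cat lo 0 (hi + r%:Z)); [|by lia|by lia].
  rewrite (@range_cat 0 r%:Z (hi + r%:Z)); [|by lia|by lia].
  rewrite !filter_cat (_ : [seq s <- range 0 r%:Z | s \in D] = [::]) //.
  rewrite -(filter_pred0 (range 0 r%:Z)); apply: eq_in_filter => s; rewrite mem_range => Hs.
  by apply/negbTE; apply: contraL Hs => /Hn.
rewrite [in LHS]ED Hl ?filter_subseq // ED map_cat; congr (ldet (_ ++ _)).
  rewrite -ED; apply/eq_in_map => s; rewrite mem_filter mem_range /phi => /and3P[_ _ s0].
  by rewrite ifT //; lia.
rewrite -ED; apply/eq_in_map => s; rewrite mem_filter mem_range /phi => /and3P[_ s0 _].
by rewrite ifF //; lia.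
Qed.

(** The equation at [s] mixes the two families only when [s + 1 = A], and there the factor of
    [phi (s + 1)] is zero. *)
Lemma merge_sys n chi (phim phip : int -> 'rV[R]_n) A :
  sys chi A phim phip ->
  let phi s := if s < A then phim s else phip s in sys chi A phi phi.
Proof.
case=> B [Hm Hp chiE] phi; suff H : eig phi A B by exists B.
move=> s; rewrite /phi; have [sA|As] := ltP s A; last first.
  by rewrite -Hp ifF //; lia.
rewrite -Hm; have [//|As1] := ltP (s + 1) A.
have -> : A - s - 1 = 0 by lia.
by rewrite !scale0r.
Qed.

Lemma sys_nil A : exists phi : int -> 'rV[R]_0,
  sys (fun=> 1) A phi phi /\ forall lo hi, cnt1 [::] lo hi phi.
Proof.
exists (fun=> 0); split.
  exists 0; split=> [s|s|x]; last by rewrite det_mx00.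
  - by rewrite !scaler0 subrr mul0mx.
  - by rewrite !scaler0 subrr mul0mx.
by move=> lo hi [|x D] _; rewrite /= /ldet //= det_mx00.
Qed.

Lemma plain_system m (A : int) :
  exists n (phi : int -> 'rV[R]_n), sys (rising m) A phi phi /\
    forall lo hi, lo <= hi -> cnt1 (plain_strips lo hi [::] m) lo (hi + m%:Z) phi.
Proof.
have [phi0 [s0 c0]] := sys_nil (A - m%:Z).
have [n [phi [s1 c1]]] := plain_iter m s0.
exists n, phi; split=> [|lo hi lohi]; last exact: c1.
by rewrite subrK in s1; apply: sys_ext s1 => x; rewrite mulr1.
Qed.

Definition half_strips lo hi m c r e :=
  plain_strips lo (hi + m%:Z + c%:Z + r%:Z)
    (inner_strips lo (hi + m%:Z + c%:Z) (outer_strips lo (hi + m%:Z) (plain_strips lo hi [::] m)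
      c c) r) e.

(** [phi] is chosen before [lo] and [hi]. The right halves of a region and of its squeezed form have
    different [hi], and comparing them requires common functions. *)
Lemma bowtie_system m c r e :
  exists n (phi : int -> 'rV[R]_n),
    sys (fun x => rising e x * (rising c (x + (e + r)%N%:R) ^+ 2 * rising m (x + (e + r +
      c)%N%:R)))
      (r%:Z + e%:Z) phi phi /\
    forall lo hi, lo <= hi -> lo <= - c%:Z -> 0 <= hi + m%:Z ->
      cnt1 (half_strips lo hi m c r e) lo (hi + m%:Z + c%:Z + r%:Z + e%:Z) phi.
Proof.
(* Starting from [- c], the [c] strips of the outer lobe bring A to 0 at C, the value from which
   [inner_iter] starts. *)
have [n0 [f0 [s0 c0]]] := plain_system m (- c%:Z).
have [n1 [f1m [f1p [s1 c1]]]] := outer_iter c s0.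
rewrite addNr in s1.
have [f2m [f2p [s2 v2 c2]]] := inner_iter r s1.
have [n3 [f3 [s3 c3]]] := plain_iter e (merge_sys s2).
exists n3, f3; split.
  by apply: sys_ext s3 => x; rewrite !natrD !addrA.
move=> lo hi lohi loc hi0.
apply: c3; first by lia.
apply: merge_cnt; [exact: v2 | lia | lia | apply: c2; [lia|lia|]].
by apply: c1 => //; apply: c0.
Qed.
End Systems.

(** * Forced lozenges *)

Lemma matchings_map_in {T1 T2 T1' T2' : eqType} (e : T1 -> T2 -> bool) (e' : T1' -> T2' -> bool)
    (f : T1 -> T1') (g : T2 -> T2') us ws :
  (forall u w, u \in us -> w \in ws -> e' (f u) (g w) = e u w) ->
  matchings e' [seq f u | u <- us] [seq g w | w <- ws] = matchings e us ws.
Proof.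
elim: us ws => [|u us IH] ws H /=; first by case: ws {H}.
rewrite picks_map big_map /= big_seq_cond [RHS]big_seq_cond.
have sub p x : p \in picks ws -> x \in p.1 :: p.2 -> x \in ws.
  by move=> /picks_perm/perm_mem->.
apply: eq_big => [p|p /andP[pw _]].
  case: (boolP (p \in picks ws)) => //= pw; rewrite H ?inE ?eqxx //.
  by apply: sub pw _; rewrite inE eqxx.
apply: IH => v w vus wp; apply: H; first by rewrite inE vus orbT.
by apply: sub pw _; rewrite inE wp orbT.
Qed.

(** Taken in order, each [x] can only be matched to [f x]: the partners of later entries are not
    adjacent to it, and neither is anything in [us]. *)
Lemma matchings_forced {T1 T2 : eqType} (e : T1 -> T2 -> bool) (f : T2 -> T1) X us ws :
  (forall x, x \in X -> e (f x) x) ->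
  (forall x u, x \in X -> u \in us -> ~~ e u x) ->
  pairwise (fun x y => ~~ e (f y) x) X ->
  matchings e (map f X ++ us) (X ++ ws) = matchings e us ws.
Proof.
elim: X => // x X IH Hf Hu; rewrite [pairwise _ _]/= => /andP[/allP Hx HX].
rewrite cat_cons matchings_cons_r /= big_cons /= Hf ?inE ?eqxx // big_map /= big_seq_cond big1
  ?addn0.
  apply: IH => // [y yX|y u yX]; first by apply: Hf; rewrite inE yX orbT.
  by apply: Hu; rewrite inE yX orbT.
move=> [u r] /andP[/picks_perm/perm_mem/(_ u)]; rewrite /= [in X in _ = X]inE eqxx /=.
rewrite mem_cat => /orP[/mapP[y /Hx ny ->]|uus]; first by rewrite (negbTE ny).
by rewrite (negbTE (Hu _ _ _ uus)) // inE eqxx.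
Qed.

Section Frozen.
Variables (us ws NU ND : seq tri) (k : int).
Hypotheses (uus : uniq us) (uws : uniq ws) (uNU : uniq NU) (uND : uniq ND).
Hypotheses (sub_u : {subset us <= NU}) (sub_d : {subset ws <= ND}).
Hypotheses (NUk : forall t, t \in NU -> t.1.1 && (k <= t.1.2)).
Hypothesis NDk : forall t, t \in ND -> ~~ t.1.1 && (k <= t.1.2).
Hypothesis frozen_d : forall i j, (false, i, j) \in ND -> (false, i, j) \notin ws ->
  [/\ (true, i, j) \notin us, (true, i, j + 1) \notin us,
      (true, i + 1, j) \in NU & (true, i + 1, j) \notin us].
Hypothesis frozen_u : forall i j, (true, i, j) \in NU -> (true, i, j) \notin us -> k < i ->
  (false, i - 1, j) \in ND /\ (false, i - 1, j) \notin ws.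

(** A down triangle omitted by the region has no neighbour in it, and is paired with the up triangle
    on its right. Beyond the first column, every omitted up triangle arises in this way. So forced
    lozenges fill the omitted part, apart from up triangles of the first column. *)
Lemma matchings_frozen (P : pred tri) : (forall t, P t -> t.1.2 = k) ->
  matchings adj [seq t <- us | ~~ P t] ws
  = matchings adj [seq t <- NU | ~~ ((t.1.2 == k) && ((t \notin us) || P t))] ND.
Proof.
move=> Pk.
pose leT (x y : tri) := x.1.2 <= y.1.2.
(* Partners lie one column further to the right, so sorting by column makes the forced pairs
   triangular. *)
pose X := sort leT [seq t <- ND | t \notin ws].
pose f (x : tri) : tri := (true, x.1.2 + 1, x.2).
have memX t : (t \in X) = (t \in ND) && (t \notin ws) by rewrite mem_sort mem_filter andbC.
have uX : uniq X by rewrite sort_uniq filter_uniq.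
have finj : {in X &, injective f}.
  move=> [[b i] j] [[b' i'] j']; rewrite !memX => /andP[/NDk /andP[/= nb _] _].
  by move=> /andP[/NDk /andP[/= nb' _] _] [/addIr -> ->]; case: b b' nb nb' => [] [].
have HD : perm_eq ND (X ++ ws).
  apply: uniq_perm => //.
    rewrite cat_uniq uX uws andbT /=; apply/hasPn => t tw.
    by rewrite /= memX tw andbF.
  move=> t; rewrite mem_cat memX; case: (boolP (t \in ws)) => [/sub_d->|_]; first by rewrite orbT.
  by rewrite orbF andbT.
have HU : perm_eq [seq t <- NU | ~~ ((t.1.2 == k) && ((t \notin us) || P t))]
                  (map f X ++ [seq t <- us | ~~ P t]).
  apply: uniq_perm; first exact: filter_uniq.
    rewrite cat_uniq (map_inj_in_uniq finj) uX filter_uniq // andbT /=.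
    apply/hasPn => t; rewrite mem_filter => /andP[_ tus]; apply/negP => /mapP[[[b i] j]].
    rewrite memX => /andP[xD xw] Et; rewrite Et in tus.
    have /andP[nb _] := NDk xD; case: b nb xD xw Et tus => // _ xD xw _ tus.
    by have [_ _ _] := frozen_d xD xw; rewrite tus.
  move=> t; rewrite mem_cat !mem_filter; apply/idP/orP.
    case/andP=> H tNU; case: (boolP (t \in us)) => tus.
      right; rewrite andbT; apply/negP => Pt; move: H; rewrite (Pk _ Pt) eqxx Pt orbT //.
    left; move: H tNU tus; case: t => [[b i] j] H tNU tus.
    have /andP[/= bt ki] := NUk tNU.
    have kli : k < i.
      by rewrite lt_neqAle ki andbT eq_sym; apply: contra H => ik; rewrite tus /= ik.
    case: b bt tNU tus {H} => // _ tNU tus; have [xD xw] := frozen_u tNU tus kli.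
    by apply/mapP; exists (false, i - 1, j); rewrite ?memX ?xD // /f /= subrK.
  case=> [/mapP[[[b i] j]]|/andP[nP tus]]; last first.
    by rewrite (sub_u tus) tus /= (negbTE nP) !andbF.
  rewrite memX => /andP[xD xw] ->; have /andP[nb /= ki] := NDk xD.
  case: b nb xD xw => // _ xD xw; have [_ _ xNU _] := frozen_d xD xw.
  by rewrite /f /= xNU andbT gt_eqF // ltzD1.
rewrite (matchings_perm_l _ _ (filter_uniq _ uNU) HU) (matchings_perm_r _ _ uND HD)
  matchings_forced //.
- by move=> [[b i] j]; rewrite memX => /andP[/NDk /andP[/= nb _] _]; rewrite /f /= adjE nb;
  clear; lia.
- move=> [[b i] j] [[b' i'] j']; rewrite memX => /andP[xD xw].
  have /andP[/= nb _] := NDk xD; case: b nb xD xw => // _ xD xw.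
  rewrite mem_filter => /andP[_ uu]; have /andP[/= b't _] := NUk (sub_u uu).
  case: b' b't uu => // _ uu; have [n1 n2 _ n3] := frozen_d xD xw.
  rewrite adjE; apply/negP => /= H.
  have : [\/ (i', j') = (i, j), (i', j') = (i, j + 1) | (i', j') = (i + 1, j)].
    clear -H.
    have [/eqP ei|/eqP ei] := boolP (i' == i); last by constructor 3; congr pair; lia.
    have [/eqP ej|/eqP ej] := boolP (j' == j); first by constructor 1; congr pair.
    by constructor 2; congr pair; lia.
  by case=> -[Ei Ej]; rewrite Ei Ej in uu; rewrite uu in n1 n2 n3.
have : pairwise (fun x y => (x != y) && leT x y) X.
  rewrite pairwise_relI -uniq_pairwise uX /= -sorted_pairwise ?sort_sorted //.
    by move=> x y; apply: le_total.
  by move=> y x z; apply: le_trans.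
apply: (@sub_in_pairwise _ (mem X)); last by apply/allP.
move=> [[b i] j] [[b' i'] j'] /=; rewrite !memX.
move=> /andP[/NDk /andP[/= nb _] _] /andP[/NDk /andP[/= nb' _] _] /andP[ne].
by rewrite /leT /f /= adjE => le; move: ne; rewrite !xpair_eqE; clear -nb nb' le;
  case: b b' nb nb' => [] []; lia.
Qed.
End Frozen.

Definition headU (l : seq strip) : seq int := if l is (U, _) :: _ then U else [::].

Lemma mem_strip_ups_head k v l j : (up k v j \in strip_ups k v l) = (j \in headU l).
Proof.
case: l => [|[U W] l] //=; rewrite mem_cat (mem_map (@up_inj k v)).
case: (boolP (j \in U)) => //= _; apply/negP => /strip_ups_ge[_ /=]; lia.
Qed.

(* [fr] marks the heights of the first line outside the region: the lozenges of the full
   half [l] starting there are forced and fill exactly what the region omits. *)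
Lemma half_count l k v us ws L (fr : pred int) Y :
  wf l -> uniq us -> uniq ws -> uniq (strip_ups k v l) -> uniq (strip_downs k v l) ->
  {subset us <= strip_ups k v l} -> {subset ws <= strip_downs k v l} ->
  (forall i j, (false, i, j) \in strip_downs k v l -> (false, i, j) \notin ws ->
    [/\ (true, i, j) \notin us, (true, i, j + 1) \notin us,
      (true, i + 1, j) \in strip_ups k v l & (true, i + 1, j) \notin us]) ->
  (forall i j, (true, i, j) \in strip_ups k v l -> (true, i, j) \notin us -> k < i ->
    (false, i - 1, j) \in strip_downs k v l /\ (false, i - 1, j) \notin ws) ->
  uniq L -> {subset headU l <= L} -> uniq Y -> {subset Y <= L} ->
  (forall j, j \in L -> fr j = (j \in headU l) && (up k v j \notin us)) ->
  (forall j, j \in Y -> ~~ fr j) ->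
  matchings adj us (map (dn (k - 1) v) Y ++ ws) = transfer l [seq j <- L | fr j || (j \in Y)].
Proof.
move=> wl uu uw uNU uND su sd fd fu uL sU uY sY frE frY.
have NUk t : t \in strip_ups k v l -> t.1.1 && (k <= t.1.2) by case/strip_ups_ge=> -> ->.
have NDk t : t \in strip_downs k v l -> ~~ t.1.1 && (k <= t.1.2) by case/strip_downs_ge=> -> ->.
rewrite -(matchings_strips k v) // ?filter_uniq // !matchings_remove ?filter_uniq //; last first.
  by move=> u /su; apply: NUk.
have -> : all (fun s => up k v s \in strip_ups k v l) [seq j <- L | fr j || (j \in Y)]
    = all (fun s => up k v s \in us) Y.
  apply/allP/allP => H j.
    move=> jY; have := H j; rewrite mem_filter jY orbT sY // mem_strip_ups_head => /(_ isT) jU.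
    by have := frY j jY; rewrite frE ?sY // jU /= negbK.
  rewrite mem_filter => /andP[/orP[fj jL|jY _]]; last exact/su/H.
  by move: fj; rewrite frE // mem_strip_ups_head => /andP[].
case: ifP => // HY.
rewrite (matchings_frozen uu uw uNU uND su sd NUk NDk fd fu); last by move=> t /mapP[j _ ->].
congr matchings; apply: eq_in_filter => t tU; congr (~~ _).
have /andP[t1 t2] := NUk _ tU.
apply/andP/mapP => [[/eqP tk H]|[j jD ->]].
  exists (t.2 - v).
    rewrite mem_filter.
    have Et : t = up k v (t.2 - v).
      by case: t t1 {t2 H} tk tU => [[b i] j] /= bt -> _; rewrite /up /= addrC subrK; case: b bt.
    have jU : t.2 - v \in headU l by rewrite -(mem_strip_ups_head k v) -Et.
    rewrite sU // andbT frE ?sU // jU -Et /=.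
    case/orP: H => [-> //|/mapP[j jY Etj]].
    by rewrite Etj /= addrC addKr jY orbT.
  by case: t t1 {t2 H} tk tU => [[b i] j] /= bt -> _; rewrite /up /= addrC subrK; case: b bt.
rewrite eqxx; split=> //; move: jD; rewrite mem_filter => /andP[/orP[fj jL|jY _]]; last first.
  by rewrite map_f ?orbT.
by move: fj; rewrite frE // => /andP[_ ->].
Qed.

(** * Triangles contained in the strips and in the region *)

Lemma mem_map_up k v U (b : bool) i j :
  ((b, i, j) \in map (up k v) U) = [&& b, i == k & j - v \in U].
Proof.
apply/mapP/and3P => [[y yU [-> -> ->]]|[bt /eqP-> jU]]; first by rewrite addrC addKr.
by exists (j - v); rewrite // /up addrC subrK; case: b bt.
Qed.

Lemma mem_map_dn k v U (b : bool) i j :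
  ((b, i, j) \in map (dn k v) U) = [&& ~~ b, i == k & j - v \in U].
Proof.
apply/mapP/and3P => [[y yU [-> -> ->]]|[bt /eqP-> jU]]; first by rewrite addrC addKr.
by exists (j - v); rewrite // /dn addrC subrK; case: b bt.
Qed.

Section StripMembership.
Variables (lo hi v : int) (l : seq strip) (i j : int).

Lemma strip_ups_plain k e : ((true, i, j) \in strip_ups k v (plain_strips lo hi l e)) =
  (k <= i < k + e%:Z) && (lo <= j - v < hi + (k + e%:Z - i))
  || ((true, i, j) \in strip_ups (k + e%:Z) v l).
Proof.
elim: e k => [|e IH] k /=; first by rewrite addr0; case: (_ \in _); lia.
rewrite mem_cat mem_map_up mem_range IH (_ : k + 1 + e%:Z = k + e.+1%:Z); last by lia.
by case: (_ \in _); lia.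
Qed.

Lemma strip_downs_plain k e : ((false, i, j) \in strip_downs k v (plain_strips lo hi l e)) =
  (k <= i < k + e%:Z) && (lo <= j - v < hi + (k + e%:Z - i) - 1)
  || ((false, i, j) \in strip_downs (k + e%:Z) v l).
Proof.
elim: e k => [|e IH] k /=; first by rewrite addr0; case: (_ \in _); lia.
rewrite mem_cat mem_map_dn mem_range IH (_ : k + 1 + e%:Z = k + e.+1%:Z); last by lia.
by case: (_ \in _); lia.
Qed.

Lemma strip_ups_outer k c q : ((true, i, j) \in strip_ups k v (outer_strips lo hi l c q)) =
  (k <= i < k + q%:Z) && ((lo <= j - v < k + q%:Z - i - c%:Z)
                           || (0 <= j - v < hi + (k + q%:Z - i)))
  || ((true, i, j) \in strip_ups (k + q%:Z) v l).
Proof.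
elim: q k => [|q IH] k /=; first by rewrite addr0; case: (_ \in _); lia.
rewrite mem_cat mem_map_up mem_cat !mem_range IH (_ : k + 1 + q%:Z = k + q.+1%:Z); last by lia.
by case: (_ \in _); lia.
Qed.

Lemma strip_downs_outer k c q : ((false, i, j) \in strip_downs k v (outer_strips lo hi l c q)) =
  (k <= i < k + q%:Z) && ((lo <= j - v < k + q%:Z - i - c%:Z - 1)
                           || (0 <= j - v < hi + (k + q%:Z - i) - 1))
  || ((false, i, j) \in strip_downs (k + q%:Z) v l).
Proof.
elim: q k => [|q IH] k /=; first by rewrite addr0; case: (_ \in _); lia.
rewrite mem_cat mem_map_dn mem_cat !mem_range IH (_ : k + 1 + q%:Z = k + q.+1%:Z); last by lia.
by case: (_ \in _); lia.
Qed.

Lemma strip_ups_inner k r : ((true, i, j) \in strip_ups k v (inner_strips lo hi l r)) =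
  (k <= i < k + r%:Z) && ((lo <= j - v < 0)
                           || (k + r%:Z - i <= j - v < hi + (k + r%:Z - i)))
  || ((true, i, j) \in strip_ups (k + r%:Z) v l).
Proof.
elim: r k => [|r IH] k /=; first by rewrite addr0; case: (_ \in _); lia.
rewrite mem_cat mem_map_up mem_cat !mem_range IH (_ : k + 1 + r%:Z = k + r.+1%:Z); last by lia.
by case: (_ \in _); lia.
Qed.

Lemma strip_downs_inner k r : ((false, i, j) \in strip_downs k v (inner_strips lo hi l r)) =
  (k <= i < k + r%:Z) && ((lo <= j - v < 0)
                           || (k + r%:Z - i - 1 <= j - v < hi + (k + r%:Z - i) - 1))
  || ((false, i, j) \in strip_downs (k + r%:Z) v l).
Proof.
elim: r k => [|r IH] k /=; first by rewrite addr0; case: (_ \in _); lia.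
rewrite mem_cat mem_map_dn mem_cat !mem_range IH (_ : k + 1 + r%:Z = k + r.+1%:Z); last by lia.
by case: (_ \in _); lia.
Qed.
End StripMembership.

Lemma wf_plain lo hi l e : wf l -> wf (plain_strips lo hi l e).
Proof. by move=> wl; elim: e => //= e ->; rewrite !range_uniq. Qed.

Lemma range_cat_uniq a b c d : b <= c -> uniq (range a b ++ range c d).
Proof.
move=> bc; rewrite cat_uniq !range_uniq andbT /=; apply/hasPn => x.
by rewrite /= !mem_range; lia.
Qed.

Lemma wf_outer lo hi l c q : (q <= c)%N -> wf l -> wf (outer_strips lo hi l c q).
Proof.
move=> qc wl; elim: q qc => //= q IH qc.
by rewrite IH ?(ltnW qc) // !range_cat_uniq //; clear -qc; lia.
Qed.

Lemma wf_inner lo hi l r : wf l -> wf (inner_strips lo hi l r).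
Proof. by move=> wl; elim: r => //= r ->; rewrite !range_cat_uniq //; clear; lia. Qed.

Lemma strip_ups_uniq k v l : wf l -> uniq (strip_ups k v l).
Proof.
elim: l k => //= -[U W] l IH k /andP[/andP[uU uW] wl].
rewrite cat_uniq map_inj_uniq ?uU; last exact: up_inj.
rewrite IH // andbT; apply/hasPn => t /strip_ups_ge[_ kt].
by apply/mapP => -[j _ Et]; rewrite Et /= in kt; clear -kt; lia.
Qed.

Lemma strip_downs_uniq k v l : wf l -> uniq (strip_downs k v l).
Proof.
elim: l k => //= -[U W] l IH k /andP[/andP[uU uW] wl].
rewrite cat_uniq map_inj_uniq ?uW; last exact: dn_inj.
rewrite IH // andbT; apply/hasPn => t /strip_downs_ge[_ kt].
by apply/mapP => -[j _ Et]; rewrite Et /= in kt; clear -kt; lia.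
Qed.

Lemma up_in_up v s i j : tri_in (in_up_tri v s) (true, i, j) =
  [&& v.1 <= i, v.2 <= j & i + j < v.1 + v.2 + s%:Z].
Proof. by case: v => x y; rewrite /tri_in /in_up_tri /=; lia. Qed.

Lemma down_in_up v s i j : tri_in (in_up_tri v s) (false, i, j) =
  [&& v.1 <= i, v.2 <= j & i + j + 1 < v.1 + v.2 + s%:Z].
Proof. by case: v => x y; rewrite /tri_in /in_up_tri /=; lia. Qed.

Lemma up_in_down v s i j : tri_in (in_down_tri v s) (true, i, j) =
  [&& j < v.2 + s%:Z, i < v.1 & v.1 + v.2 <= i + j].
Proof. by case: v => x y; rewrite /tri_in /in_down_tri /=; lia. Qed.

Lemma down_in_down v s i j : tri_in (in_down_tri v s) (false, i, j) =
  [&& j < v.2 + s%:Z, i < v.1 & v.1 + v.2 <= i + j + 1].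
Proof. by case: v => x y; rewrite /tri_in /in_down_tri /=; lia. Qed.

Lemma up_in_H T i j : tri_in (inH T) (true, i, j) =
  [&& jS T <= j < jN T, sS T <= i + j < sN T & iW T <= i < iE T].
Proof. by rewrite /tri_in /inH /=; lia. Qed.

Lemma down_in_H T i j : tri_in (inH T) (false, i, j) =
  [&& jS T <= j < jN T, sS T <= i + j + 1 < sN T & iW T <= i < iE T].
Proof. by rewrite /tri_in /inH /=; lia. Qed.

Lemma mem_region T t : (t \in region T) = tri_in (inH T) t &&
     ~~ [|| tri_in (in_down_tri (lobeA_out_bot T) (ta T)) t,
            tri_in (in_up_tri (lobeA_in_bl T) (ta' T)) t,
            tri_in (in_up_tri (lobeB_in_bl T) (tb' T)) t,
            tri_in (in_down_tri (lobeB_out_bot T) (tb T)) t,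
            tri_in (in_up_tri (lobeC_in_bl T) (tc' T)) t |
            tri_in (in_down_tri (lobeC_out_bot T) (tc T)) t].
Proof.
rewrite /region mem_filter; case: (boolP (tri_in (inH T) t)) => //= Ht.
case: (_ || _) => //=; case: t Ht => [[b i] j] Ht.
apply/flattenP; eexists; first by apply: (map_f _ (x := b)); case: b {Ht}.
have {}Ht : [&& jS T <= j, j < jN T, iW T <= i & i < iE T].
  by case: b Ht; rewrite ?up_in_H ?down_in_H => /and3P[/andP[-> ->] _ /andP[-> ->]].
apply/allpairsP; exists (`|i - iW T|, `|j - jS T|)%N; split=> /=.
- by rewrite mem_iota; lia.
- by rewrite mem_iota; lia.
- by congr (_, _, _); lia.
Qed.

(** * The two halves of a triad hexagon *)

(* Half-plane form of the inclusions in [triad_ok]. *)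
Definition inclusions (T : triad) : bool :=
  [&& (ta' T + tb' T + tc' T <= tf T)%N,
   [&& jN T + iW T <= sN T, sN T <= jN T + iE T, iE T + jS T <= sN T,
     sS T <= iE T + jS T, iW T + jS T <= sS T & sS T <= jN T + iW T],
   [&& fq T + (tf T)%:Z + (ta T)%:Z <= jN T, iW T <= fp T - (ta T)%:Z,
       fp T + fq T + (tf T)%:Z + (ta T)%:Z <= sN T, jS T <= fq T + (tf T)%:Z - (ta' T)%:Z,
       sS T <= fp T + fq T + (tf T)%:Z - (ta' T)%:Z & fp T + (ta' T)%:Z <= iE T],
   [&& jS T <= fq T - (tb T)%:Z, sS T <= fp T + fq T - (tb T)%:Z, iW T <= fp T - (tb T)%:Z,
       fq T + (tb' T)%:Z <= jN T, fp T + (tb' T)%:Z <= iE T & fp T + fq T + (tb' T)%:Z <= sN T] &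
   [&& iW T <= fp T + (tf T)%:Z - (tc' T)%:Z, sS T <= fp T + fq T + (tf T)%:Z - (tc' T)%:Z,
       fq T + (tc' T)%:Z <= jN T, fp T + (tf T)%:Z + (tc T)%:Z <= iE T, jS T <= fq T - (tc T)%:Z &
       fp T + fq T + (tf T)%:Z + (tc T)%:Z <= sN T]].

Lemma triad_inclusions T : triad_ok T -> inclusions T.
Proof.
case=> Hf [h1 [h2 [h3 [h4 [h5 [h6]]]]]].
rewrite /bowties_in_H !all_cat /= /inH /lobeA_out_bot /lobeA_in_bl
  /lobeB_in_bl /lobeB_out_bot /lobeC_in_bl /lobeC_out_bot /ptA /ptB /ptC /= /inclusions.
by lia.
Qed.

Lemma strip_ups_half (p q js sn ie i j : int) (f c r m : nat) : (r <= f)%N ->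
  ie = p + f%:Z + c%:Z + m%:Z -> js <= q -> p + q + f%:Z <= sn ->
  ((true, i, j) \in strip_ups p q (half_strips (js - q) (sn - ie - q) m c r (f - r))) =
  [&& p <= i < ie, js <= j, i + j < sn &
  ~~ ([&& p + f%:Z - r%:Z <= i, q <= j & i + j < p + q + f%:Z]
   || [&& j < q, i < p + f%:Z + c%:Z & p + q + f%:Z <= i + j])].
Proof.
move=> rising Em jSq fsN; rewrite /half_strips strip_ups_plain strip_ups_inner strip_ups_outer
  strip_ups_plain in_nil orbF.
rewrite (_ : p + (f - r)%N%:Z = p + f%:Z - r%:Z); last by lia.
rewrite (_ : p + f%:Z - r%:Z + r%:Z = p + f%:Z); last by lia.
lia.
Qed.

Lemma strip_downs_half (p q js sn ie i j : int) (f c r m : nat) : (r <= f)%N ->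
  ie = p + f%:Z + c%:Z + m%:Z -> js <= q -> p + q + f%:Z <= sn ->
  ((false, i, j) \in strip_downs p q (half_strips (js - q) (sn - ie - q) m c r (f - r))) =
  [&& p <= i < ie, js <= j, i + j + 1 < sn &
  ~~ ([&& p + f%:Z - r%:Z <= i, q <= j & i + j + 1 < p + q + f%:Z]
   || [&& j < q, i < p + f%:Z + c%:Z & p + q + f%:Z <= i + j + 1])].
Proof.
move=> rising Em jSq fsN; rewrite /half_strips strip_downs_plain strip_downs_inner
  strip_downs_outer strip_downs_plain in_nil orbF.
rewrite (_ : p + (f - r)%N%:Z = p + f%:Z - r%:Z); last by lia.
rewrite (_ : p + f%:Z - r%:Z + r%:Z = p + f%:Z); last by lia.
lia.
Qed.

Lemma wf_half lo hi m c r e : wf (half_strips lo hi m c r e).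
Proof. by apply: wf_plain; apply: wf_inner; apply: wf_outer => //; apply: wf_plain. Qed.

Section HalfRegions.
Variable T : triad.
Hypothesis gT : inclusions T.
Let p := fp T. Let q := fq T.

Lemma region_upR i j : p <= i -> ((true, i, j) \in region T) =
  [&& jS T <= j < jN T, sS T <= i + j < sN T, i < iE T &
  ~~ [|| (q + (tf T)%:Z - (ta' T)%:Z <= j) && (i + j < p + q + (tf T)%:Z),
      (q <= j) && (i + j < p + q + (tb' T)%:Z),
      [&& p + (tf T)%:Z - (tc' T)%:Z <= i, q <= j & i + j < p + q + (tf T)%:Z] |
      [&& j < q, i < p + (tf T)%:Z + (tc T)%:Z & p + q + (tf T)%:Z <= i + j]]].
Proof.
move=> pi; rewrite mem_region up_in_H !up_in_up !up_in_down /lobeA_out_bot /lobeA_in_bl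
  /lobeB_in_bl /lobeB_out_bot /lobeC_in_bl /lobeC_out_bot /ptA /ptB /ptC /=.
by move: gT pi; rewrite /inclusions /p /q; lia.
Qed.

Lemma region_downR i j : p <= i -> ((false, i, j) \in region T) =
  [&& jS T <= j < jN T, sS T <= i + j + 1 < sN T, i < iE T &
  ~~ [|| (q + (tf T)%:Z - (ta' T)%:Z <= j) && (i + j + 1 < p + q + (tf T)%:Z),
      (q <= j) && (i + j + 1 < p + q + (tb' T)%:Z),
      [&& p + (tf T)%:Z - (tc' T)%:Z <= i, q <= j & i + j + 1 < p + q + (tf T)%:Z] |
      [&& j < q, i < p + (tf T)%:Z + (tc T)%:Z & p + q + (tf T)%:Z <= i + j + 1]]].
Proof.
move=> pi; rewrite mem_region down_in_H !down_in_up !down_in_down /lobeA_out_bot /lobeA_in_bl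
  /lobeB_in_bl /lobeB_out_bot /lobeC_in_bl /lobeC_out_bot /ptA /ptB /ptC /=.
by move: gT pi; rewrite /inclusions /p /q; lia.
Qed.

Lemma region_upL i j : i < p -> ((true, i, j) \in region T) =
  [&& jS T <= j < jN T, sS T <= i + j < sN T, iW T <= i &
  ~~ ((j < q + (tf T)%:Z + (ta T)%:Z) && (p + q + (tf T)%:Z <= i + j)
   || (j < q) && (p + q - (tb T)%:Z <= i + j))].
Proof.
move=> pi; rewrite mem_region up_in_H !up_in_up !up_in_down /lobeA_out_bot /lobeA_in_bl
  /lobeB_in_bl /lobeB_out_bot /lobeC_in_bl /lobeC_out_bot /ptA /ptB /ptC /=.
by move: gT pi; rewrite /inclusions /p /q; lia.
Qed.

Lemma region_downL i j : i < p -> ((false, i, j) \in region T) =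
  [&& jS T <= j < jN T, sS T <= i + j + 1 < sN T, iW T <= i &
  ~~ ((j < q + (tf T)%:Z + (ta T)%:Z) && (p + q + (tf T)%:Z <= i + j + 1)
   || (j < q) && (p + q - (tb T)%:Z <= i + j + 1))].
Proof.
move=> pi; rewrite mem_region down_in_H !down_in_up !down_in_down /lobeA_out_bot /lobeA_in_bl
  /lobeB_in_bl /lobeB_out_bot /lobeC_in_bl /lobeC_out_bot /ptA /ptB /ptC /=.
by move: gT pi; rewrite /inclusions /p /q; lia.
Qed.
End HalfRegions.

(** * The cut along AB *)

Section Cut.
Variable T : triad.

(* Heights on the line [AB] are measured from [B]. When the inner lobe of [C] reaches [AB],
   its heights stay in [edges]: their terms vanish. *)
Definition edges : seq int :=
  [seq j <- range (jS T - fq T) (jN T - fq T) |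
    [&& sS T - fp T - fq T <= j, j < sN T - fp T - fq T,
        ~~ (- (tb T)%:Z <= j < (tb' T)%:Z) &
        ~~ ((tf T)%:Z - (ta' T)%:Z <= j < (tf T)%:Z + (ta T)%:Z)]].

(** The strips of the right half ignore the N and SW sides and the inner lobes of A and B; these are
    the heights on AB where they overshoot the region. On the left, the NE and S sides and the outer
    lobes play this part. *)
Definition frozenR (j : int) : bool :=
  [|| jN T - fq T <= j, j < sS T - fp T - fq T,
      (tf T)%:Z - (ta' T)%:Z <= j < (tf T)%:Z | 0 <= j < (tb' T)%:Z].
Definition frozenL (j : int) : bool :=
  [|| sN T - fp T - fq T <= j, j < jS T - fq T,
      (tf T)%:Z <= j < (tf T)%:Z + (ta T)%:Z | - (tb T)%:Z <= j < 0].

Definition lineR := range (jS T - fq T) (sN T - fp T - fq T).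
Definition lineL := range (sS T - fp T - fq T) (jN T - fq T).
Definition confR (Y : seq int) := [seq j <- lineR | frozenR j || (j \in Y)].
Definition confL (Y : seq int) := [seq j <- lineL | frozenL j || (j \in Y)].

Definition stripsR := half_strips (jS T - fq T) (sN T - iE T - fq T)
  `|(iE T - fp T - (tf T)%:Z - (tc T)%:Z)%R|%N (tc T) (tc' T) (tf T - tc' T).
Definition stripsL :=
  plain_strips (sS T - (fp T + fq T)) (jN T - fq T - (fp T - iW T)) [::] `|(fp T - iW T)%R|%N.

Definition usR := [seq t <- ups (region T) | fp T <= t.1.2].
Definition wsR := [seq t <- downs (region T) | fp T <= t.1.2].
Definition usL := [seq t <- ups (region T) | t.1.2 < fp T].
Definition wsL := [seq t <- downs (region T) | t.1.2 < fp T].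

Lemma mem_ups b i j : ((b, i, j) \in ups (region T)) = b && ((b, i, j) \in region T).
Proof. by rewrite mem_filter mem_undup. Qed.
Lemma mem_downs b i j : ((b, i, j) \in downs (region T)) = ~~ b && ((b, i, j) \in region T).
Proof. by rewrite mem_filter mem_undup. Qed.

Hypothesis gT : inclusions T.

Lemma mem_stripsR_up i j : ((true, i, j) \in strip_ups (fp T) (fq T) stripsR) =
  [&& fp T <= i < iE T, jS T <= j, i + j < sN T &
  ~~ ([&& fp T + (tf T)%:Z - (tc' T)%:Z <= i, fq T <= j & i + j < fp T + fq T + (tf T)%:Z]
   || [&& j < fq T, i < fp T + (tf T)%:Z + (tc T)%:Z & fp T + fq T + (tf T)%:Z <= i + j])].
Proof. by apply: strip_ups_half; move: gT; rewrite /inclusions; lia. Qed.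

Lemma mem_stripsR_down i j : ((false, i, j) \in strip_downs (fp T) (fq T) stripsR) =
  [&& fp T <= i < iE T, jS T <= j, i + j + 1 < sN T &
  ~~ ([&& fp T + (tf T)%:Z - (tc' T)%:Z <= i, fq T <= j & i + j + 1 < fp T + fq T + (tf T)%:Z]
   || [&& j < fq T, i < fp T + (tf T)%:Z + (tc T)%:Z & fp T + fq T + (tf T)%:Z <= i + j + 1])].
Proof. by apply: strip_downs_half; move: gT; rewrite /inclusions; lia. Qed.

Lemma mem_usR b i j : ((b, i, j) \in usR) = [&& b, fp T <= i & (b, i, j) \in region T].
Proof. by rewrite mem_filter mem_ups andbCA. Qed.
Lemma mem_wsR b i j : ((b, i, j) \in wsR) = [&& ~~ b, fp T <= i & (b, i, j) \in region T].
Proof. by rewrite mem_filter mem_downs andbCA. Qed.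

Lemma mem_usR_up i j : ((true, i, j) \in usR) =
  [&& fp T <= i, jS T <= j < jN T, sS T <= i + j < sN T, i < iE T &
  ~~ [|| (fq T + (tf T)%:Z - (ta' T)%:Z <= j) && (i + j < fp T + fq T + (tf T)%:Z),
      (fq T <= j) && (i + j < fp T + fq T + (tb' T)%:Z),
      [&& fp T + (tf T)%:Z - (tc' T)%:Z <= i, fq T <= j & i + j < fp T + fq T + (tf T)%:Z] |
      [&& j < fq T, i < fp T + (tf T)%:Z + (tc T)%:Z & fp T + fq T + (tf T)%:Z <= i + j]]].
Proof. by rewrite mem_usR /=; case: (boolP (fp T <= i)) => // pi; rewrite region_upR. Qed.

Lemma mem_wsR_down i j : ((false, i, j) \in wsR) =
  [&& fp T <= i, jS T <= j < jN T, sS T <= i + j + 1 < sN T, i < iE T &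
  ~~ [|| (fq T + (tf T)%:Z - (ta' T)%:Z <= j) && (i + j + 1 < fp T + fq T + (tf T)%:Z),
      (fq T <= j) && (i + j + 1 < fp T + fq T + (tb' T)%:Z),
      [&& fp T + (tf T)%:Z - (tc' T)%:Z <= i, fq T <= j & i + j + 1 < fp T + fq T + (tf T)%:Z] |
      [&& j < fq T, i < fp T + (tf T)%:Z + (tc T)%:Z & fp T + fq T + (tf T)%:Z <= i + j + 1]]].
Proof. by rewrite mem_wsR /=; case: (boolP (fp T <= i)) => // pi; rewrite region_downR. Qed.

Lemma right_count Y : subseq Y edges ->
  matchings adj usR (map (dn (fp T - 1) (fq T)) Y ++ wsR) = transfer stripsR (confR Y).
Proof.
move=> HY; have uY : uniq Y := subseq_uniq HY (filter_uniq _ (range_uniq _ _)).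
have YE j : j \in Y -> j \in edges by apply: mem_subseq.
apply: half_count; rewrite ?wf_half ?range_uniq //.
- by rewrite !filter_uniq ?undup_uniq.
- by rewrite !filter_uniq ?undup_uniq.
- exact: strip_ups_uniq (wf_half _ _ _ _ _ _).
- exact: strip_downs_uniq (wf_half _ _ _ _ _ _).
- move=> [[[] i] j]; last by rewrite mem_usR.
  by rewrite mem_usR_up mem_stripsR_up; move: gT; rewrite /inclusions; lia.
- move=> [[[] i] j]; first by rewrite mem_wsR.
  by rewrite mem_wsR_down mem_stripsR_down; move: gT; rewrite /inclusions; lia.
- move=> i j; rewrite mem_stripsR_down mem_wsR_down !mem_usR_up !mem_stripsR_up => H1 H2.
  by move: gT H1 H2; rewrite /inclusions; clear; split; lia.
- move=> i j; rewrite mem_stripsR_up mem_usR_up mem_stripsR_down mem_wsR_down => H1 H2 H3.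
  by move: gT H1 H2 H3; rewrite /inclusions; clear; split; lia.
- move=> j; rewrite -(mem_strip_ups_head (fp T) (fq T)) mem_stripsR_up mem_range => H.
  by move: gT H; rewrite /inclusions; clear; lia.
- move=> j /YE; rewrite mem_filter !mem_range => H.
  by move: gT H; rewrite /inclusions; clear; lia.
- move=> j; rewrite -(mem_strip_ups_head (fp T) (fq T)) mem_stripsR_up mem_usR_up mem_range => H.
  by move: gT H; rewrite /inclusions /frozenR; clear; lia.
- move=> j /YE; rewrite mem_filter !mem_range => H.
  by move: gT H; rewrite /inclusions /frozenR; clear; lia.
Qed.

Lemma mem_usL_up i j : ((true, i, j) \in usL) =
  [&& i < fp T, jS T <= j < jN T, sS T <= i + j < sN T, iW T <= i &
  ~~ ((j < fq T + (tf T)%:Z + (ta T)%:Z) && (fp T + fq T + (tf T)%:Z <= i + j)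
   || (j < fq T) && (fp T + fq T - (tb T)%:Z <= i + j))].
Proof.
by rewrite mem_filter mem_ups /=; case: (boolP (i < fp T)) => // pi; rewrite region_upL.
Qed.

Lemma mem_wsL_down i j : ((false, i, j) \in wsL) =
  [&& i < fp T, jS T <= j < jN T, sS T <= i + j + 1 < sN T, iW T <= i &
  ~~ ((j < fq T + (tf T)%:Z + (ta T)%:Z) && (fp T + fq T + (tf T)%:Z <= i + j + 1)
   || (j < fq T) && (fp T + fq T - (tb T)%:Z <= i + j + 1))].
Proof.
by rewrite mem_filter mem_downs /=; case: (boolP (i < fp T)) => // pi; rewrite region_downL.
Qed.

(* A reflection of the lattice exchanging up and down triangles; it carries the
   part of the region left of [AB] to the shape of the right part. *)
Definition flip (t : tri) : tri :=
  (~~ t.1.1, - t.1.2 - 1, t.1.2 + t.2 + (if t.1.1 then 0 else 1)).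

Lemma flip_inj : injective flip.
Proof.
move=> [[b i] j] [[b' i'] j'] [] /negb_inj -> /addIr/oppr_inj ->.
by case: b' => /addIr/addrI ->.
Qed.

Lemma adj_flip (u w : tri) : u.1.1 -> ~~ w.1.1 -> adj (flip w) (flip u) = adj u w.
Proof.
case: u w => [[[] i] j] [[[] i'] j'] //= _ _.
by rewrite /flip !adjE /=; lia.
Qed.

Lemma mem_flip_up i j : ((true, i, j) \in map flip wsL) = ((false, - i - 1, i + j) \in wsL).
Proof.
have -> : (true, i, j) = flip (false, - i - 1, i + j) by congr (_, _, _) => /=; lia.
exact: mem_map flip_inj _ _.
Qed.

Lemma mem_flip_down i j : ((false, i, j) \in map flip usL) = ((true, - i - 1, i + j + 1) \in usL).
Proof.
have -> : (false, i, j) = flip (true, - i - 1, i + j + 1) by congr (_, _, _) => /=; lia.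
exact: mem_map flip_inj _ _.
Qed.

Lemma flip_wsL_up b i j : (b, i, j) \in map flip wsL -> b.
Proof. by case/mapP => [[[[] k] w]]; rewrite mem_filter mem_downs ?andbF // => _ [->]. Qed.

Lemma flip_usL_down b i j : (b, i, j) \in map flip usL -> ~~ b.
Proof. by case/mapP => [[[[] k] w]]; rewrite mem_filter mem_ups ?andbF // => _ [->]. Qed.

Lemma mem_stripsL_up i j : ((true, i, j) \in strip_ups (- fp T) (fp T + fq T) stripsL) =
  [&& - fp T <= i < - iW T, sS T <= j & i + j < jN T].
Proof. by rewrite strip_ups_plain in_nil orbF; move: gT; rewrite /inclusions; lia. Qed.

Lemma mem_stripsL_down i j : ((false, i, j) \in strip_downs (- fp T) (fp T + fq T) stripsL) =
  [&& - fp T <= i < - iW T, sS T <= j & i + j + 1 < jN T].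
Proof. by rewrite strip_downs_plain in_nil orbF; move: gT; rewrite /inclusions; lia. Qed.

(** Left down triangles at the heights [Y] are used by lozenges crossing the line. After the flip
    they are up triangles of the first column, and fictitious down triangles in the column before it
    take them away. *)
Lemma left_count Y : subseq Y edges ->
  matchings adj (map flip wsL) (map (dn (- fp T - 1) (fp T + fq T)) Y ++ map flip usL)
  = transfer stripsL (confL Y).
Proof.
move=> HY; have uY : uniq Y := subseq_uniq HY (filter_uniq _ (range_uniq _ _)).
have YE j : j \in Y -> j \in edges by apply: mem_subseq.
have wl : wf stripsL by apply: wf_plain.
apply: half_count; rewrite ?range_uniq ?strip_ups_uniq ?strip_downs_uniq //.
- by rewrite (map_inj_uniq flip_inj) !filter_uniq ?undup_uniq.
- by rewrite (map_inj_uniq flip_inj) !filter_uniq ?undup_uniq.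
- move=> [[[] i] j]; last by move/flip_wsL_up.
  by rewrite mem_flip_up mem_wsL_down mem_stripsL_up; move: gT; rewrite /inclusions; lia.
- move=> [[[] i] j]; first by move/flip_usL_down.
  by rewrite mem_flip_down mem_usL_up mem_stripsL_down; move: gT; rewrite /inclusions; lia.
- move=> i j; rewrite mem_stripsL_down mem_flip_down mem_usL_up !mem_flip_up !mem_wsL_down
    !mem_stripsL_up => H1 H2.
  by move: gT H1 H2; rewrite /inclusions; clear; split; lia.
- move=> i j; rewrite mem_stripsL_up mem_flip_up mem_wsL_down mem_stripsL_down mem_flip_down
    mem_usL_up => H1 H2 H3.
  by move: gT H1 H2 H3; rewrite /inclusions; clear; split; lia.
- move=> j; rewrite -(mem_strip_ups_head (- fp T) (fp T + fq T)) mem_stripsL_up mem_range => H.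
  by move: gT H; rewrite /inclusions; clear; lia.
- move=> j /YE; rewrite mem_filter !mem_range => H.
  by move: gT H; rewrite /inclusions; clear; lia.
- move=> j; rewrite -(mem_strip_ups_head (- fp T) (fp T + fq T)) mem_stripsL_up mem_flip_up
    mem_wsL_down mem_range => H.
  by move: gT H; rewrite /inclusions /frozenL; clear; lia.
- move=> j /YE; rewrite mem_filter !mem_range => H.
  by move: gT H; rewrite /inclusions /frozenL; clear; lia.
Qed.

Lemma M_cut : M (region T) =
  (\sum_(p <- splits edges) transfer stripsL (confL p.2) * transfer stripsR (confR p.2))%N.
Proof.
rewrite M_matchings.
have uU : uniq (ups (region T)) by rewrite filter_uniq ?undup_uniq.
have uD : uniq (downs (region T)) by rewrite filter_uniq ?undup_uniq.
have HU : perm_eq (ups (region T)) (usL ++ usR).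
  rewrite perm_sym /usR (eq_filter (a2 := predC (fun t : tri => t.1.2 < fp T))).
    by rewrite perm_filterC.
  by move=> t; rewrite /= -leNgt.
have HD : perm_eq (downs (region T)) (wsL ++ wsR).
  rewrite perm_sym /wsR (eq_filter (a2 := predC (fun t : tri => t.1.2 < fp T))).
    by rewrite perm_filterC.
  by move=> t; rewrite /= -leNgt.
rewrite (matchings_perm_l _ _ uU HU) (matchings_perm_r _ _ uD HD).
have uE : uniq edges := filter_uniq _ (range_uniq _ _).
pose dE := map (dn (fp T - 1) (fq T)).
have iWfp : iW T <= fp T by move: gT; rewrite /inclusions; clear; lia.
(* When AB lies on the NW side there is no left half, although [edges] may be nonempty; only the
   empty set of crossings contributes. *)
have [fpW|Wfp] := leP (fp T) (iW T).
  have L0 (s : seq tri) : (forall t, t \in s -> False) -> s = [::].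
    by case: s => // t s H; case: (H t); rewrite inE eqxx.
  have usL0 : usL = [::].
    apply: L0 => -[[[] i] j]; rewrite ?mem_usL_up; last by rewrite mem_filter mem_ups andbF.
    by clear -fpW; lia.
  have wsL0 : wsL = [::].
    apply: L0 => -[[[] i] j]; rewrite ?mem_wsL_down; first by rewrite mem_filter mem_downs andbF.
    by clear -fpW; lia.
  transitivity (\sum_(p <- splits edges) nilp p.2 * matchings adj usR (dE p.2 ++ wsR))%N.
    rewrite (@sum_splits_left _ (fun X Y => nilp Y * matchings adj usR (dE Y ++ wsR))%N) /=.
      by rewrite mul1n usL0 wsL0.
    by move=> X [|y Y].
  rewrite big_seq [RHS]big_seq; apply: eq_bigr => p /splits_subseq_r Hp.
  by rewrite -left_count // -right_count // usL0 wsL0 cats0 /=; case: (p.2).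
have inL j : j \in edges -> dn (fp T - 1) (fq T) j \in wsL.
  rewrite mem_filter mem_range mem_wsL_down => H.
  by move: gT H Wfp; rewrite /inclusions; clear; lia.
pose wsB := [seq t <- wsL | t \notin dE edges].
have uwL : uniq wsL by rewrite filter_uniq.
have udE s : uniq s -> uniq (dE s) by move=> us; rewrite (map_inj_uniq (@dn_inj _ _)).
have HB s : subseq s edges -> perm_eq (wsB ++ dE s) [seq t <- wsL | (t \notin dE edges) || (t
  \in dE s)].
  move=> Hs; apply: uniq_perm; last 1 first.
  - move=> t; rewrite mem_cat [t \in wsB]mem_filter [RHS]mem_filter.
    case: (boolP (t \in dE s)) => Ht; rewrite ?orbF ?orbT //.
    by case/mapP: Ht => j /(mem_subseq Hs)/inL Hj ->; rewrite Hj.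
  - rewrite cat_uniq filter_uniq // udE ?(subseq_uniq Hs) // andbT /=.
    apply/hasPn => t Ht; rewrite /= [t \in wsB]mem_filter (_ : t \in dE edges) //.
    by case/mapP: Ht => j /(mem_subseq Hs) Hj ->; apply: map_f.
  - exact: filter_uniq.
have HwL : perm_eq (wsL ++ wsR) (wsB ++ dE edges ++ wsR).
  rewrite catA perm_cat2r perm_sym (perm_trans (HB _ (subseq_refl _))) //.
  by rewrite (eq_filter (a2 := predT)) ?filter_predT // => t; rewrite orNb.
have uLR : uniq (wsL ++ wsR) by rewrite -(perm_uniq HD).
rewrite (matchings_perm_r _ _ uLR HwL).
(* Only the down triangles [dE edges], immediately left of the line, can be matched from both
   sides. *)
rewrite matchings_cat; last 2 first.
- move=> [[b i] j] [[b' i'] j'] Hu; rewrite [_ \in wsB]mem_filter => /andP[w1 w2].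
  have b1 : b by move: Hu; rewrite mem_usR; case/andP.
  have b2 : ~~ b' by move: w2; rewrite mem_filter mem_downs /= => /and3P[].
  case: b b' b1 b2 Hu w1 w2 => [] [] // _ _.
  rewrite mem_usR_up mem_map_dn mem_filter mem_range mem_wsL_down adjE.
  by move: gT; rewrite /inclusions; clear; lia.
- move=> u w; rewrite !mem_filter => /andP[/= u1 _] /andP[w1 _].
  by case: u w u1 w1 => [[b i] j] [[b' i'] j'] /= u1 w1; rewrite adjE; clear -u1 w1; lia.
rewrite splits_map big_map big_seq [RHS]big_seq; apply: eq_bigr => p Hp /=.
have Hp2 := splits_subseq_r Hp.
rewrite right_count // -left_count //; congr (_ * _)%N.
have Hp12 := splits_perm Hp.
have up2 : uniq p.2 := subseq_uniq Hp2 uE.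
rewrite matchings_remove ?(map_inj_uniq flip_inj) //; last first.
  move=> [[b i] j] Ht; have b1 := flip_wsL_up Ht; case: b b1 Ht => // _.
  by rewrite mem_flip_up mem_wsL_down /=; clear; lia.
have rE j : up (- fp T) (fp T + fq T) j = flip (dn (fp T - 1) (fq T) j).
  by congr (_, _, _) => /=; clear; lia.
rewrite ifT; last first.
  by apply/allP => j /(mem_subseq Hp2)/inL Hj /=; rewrite rE; apply: map_f.
rewrite (eq_map rE) (map_comp flip (dn (fp T - 1) (fq T))) filter_map.
have Hperm : perm_eq (wsB ++ dE p.1) [seq t <- wsL | t \notin dE p.2].
  rewrite (perm_trans (HB _ _)) ?(splits_subseq_l Hp) //.
  rewrite (_ : [seq t <- wsL | _ ] = [seq t <- wsL | t \notin dE p.2]) //.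
  apply: eq_in_filter => t _; rewrite /dE.
  case: t => [[b i] j]; rewrite !mem_map_dn.
  case: b => //=; case: (i == _) => //=.
  have := perm_mem Hp12 (j - fq T); rewrite mem_cat => ->.
  move: uE; rewrite (perm_uniq Hp12) cat_uniq => /and3P[_ /hasPn H _].
  case: (boolP (_ \in p.2)) => [/H/negbTE /= -> //|_]; by case: (_ \in _).
rewrite (eq_filter (a2 := fun t => t \notin dE p.2)); last first.
  by move=> t /=; rewrite (mem_map flip_inj).
rewrite (matchings_perm_r _ _ _ Hperm); last first.
  by rewrite (perm_uniq Hperm) filter_uniq.
rewrite matchings_tr -(matchings_map_in (e' := adj) (f := flip) (g := flip)) // => w u.
rewrite !mem_filter => /and3P[_ _ /andP[w1 _]] /and3P[_ u1 _].
by rewrite adj_flip.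
Qed.
End Cut.

(** * Squeezing out the bowtie at A by one unit *)

Definition squeezeA (d : nat) (T : triad) : triad :=
  Triad (tx T) (ty T) (tz T) (ta T + d) (tb T) (tc T) (ta' T - d) (tb' T) (tc' T)
    (tf T - d) (fp T) (fq T + d%:Z)
    (jN T + d%:Z) (jS T + d%:Z) (sN T + d%:Z) (sS T + d%:Z) (iE T - d%:Z) (iW T - d%:Z).

Definition dist (a j : int) : rat := `|(j - a)%R|%N%:R.

(** The entries of the interval are increasing, so the signs in [ldet_insert] make every factor a
    distance: A - s below [A] and s - A above it. *)
Lemma ldet_insert_range n chi A (phi g : int -> 'rV[rat]_n) s0 lo hi (P : pred int) :
  sys chi A phi phi -> (forall s, g s = phi s + g (s + 1)) -> g s0 = 0 ->
  A \in range lo hi -> ~~ P A ->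
  ldet [seq row_mx (g s) (1 : 'rV[rat]_1) | s <- [seq j <- range lo hi | (j == A) || P j]] * chi 0
  = (\prod_(j <- [seq j <- range lo hi | P j]) dist A j) * ldet (map phi [seq j <- range lo hi |
    P j]).
Proof.
move=> Hs gE g0; rewrite mem_range => /andP[loA Ahi] PA.
have -> : range lo hi = range lo A ++ A :: range (A + 1) hi.
  by rewrite -range_cons // -range_cat //; clear -Ahi; lia.
rewrite !filter_cat /= eqxx /= (negbTE PA).
have -> : [seq j <- range lo A | (j == A) || P j] = [seq j <- range lo A | P j].
  by apply: eq_in_filter => j; rewrite mem_range; case: eqP => // ->; rewrite ltxx andbF.
have -> : [seq j <- range (A + 1) hi | (j == A) || P j] = [seq j <- range (A + 1) hi | P j].
  by apply: eq_in_filter => j; rewrite mem_range; case: eqP => // ->; clear; lia.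
rewrite (ldet_insert _ _ Hs gE g0) big_cat /=; congr (_ * _ * _).
  rewrite big_seq [RHS]big_seq; apply: eq_bigr => j; rewrite mem_filter mem_range => H.
  rewrite /dist pmulrn; congr (_ %:~R); clear -H; lia.
rewrite big_seq [RHS]big_seq; apply: eq_bigr => j; rewrite mem_filter mem_range => H.
rewrite /dist pmulrn; congr (_ %:~R); clear -H; lia.
Qed.

Lemma prod_conf lo hi (fr : pred int) Y (F : int -> rat) :
  uniq Y -> {subset Y <= range lo hi} -> (forall j, j \in Y -> ~~ fr j) ->
  \prod_(j <- [seq j <- range lo hi | fr j || (j \in Y)]) F j
  = \prod_(j <- [seq j <- range lo hi | fr j]) F j * \prod_(j <- Y) F j.
Proof.
move=> uY sY frY; rewrite -big_cat; apply: perm_big.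
apply: uniq_perm; first by rewrite filter_uniq ?range_uniq.
  rewrite cat_uniq uY filter_uniq ?range_uniq // andbT /=.
  by apply/hasPn => j /frY; rewrite /= mem_filter => /negbTE->.
move=> j; rewrite mem_cat !mem_filter andb_orl; case: (boolP (j \in Y)) => [/sY->|];
  by rewrite ?orbT.
Qed.

Section UnitSqueeze.
Variable T : triad.
Hypotheses (gT : inclusions T) (gQ : inclusions (squeezeA 1 T)) (a'0 : (0 < ta' T)%N).
Let Q := squeezeA 1 T.
Let alpha : int := (tf T)%:Z - 1.

(** B moves up by one unit, and the ends of the relevant stretches of the line AB move with it, so
    heights measured from B are unchanged. The height [alpha] passes from the inner to the outer
    lobe of A, and is excluded both before and after. *)
Lemma edges_squeezeA : edges Q = edges T.
Proof.
rewrite /edges /=; move: a'0 gT; rewrite /inclusions => H1 H2.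
rewrite (_ : jS T + 1 - (fq T + 1) = jS T - fq T); last by clear; lia.
rewrite (_ : jN T + 1 - (fq T + 1) = jN T - fq T); last by clear; lia.
by apply: eq_filter => j; lia.
Qed.

Lemma lineR_squeezeA : lineR Q = lineR T.
Proof. by rewrite /lineR /=; congr range; lia. Qed.

Lemma lineL_squeezeA : lineL Q = lineL T.
Proof. by rewrite /lineL /=; congr range; lia. Qed.

Lemma frozenR_squeezeA j : j \in lineR T -> frozenR T j = (j == alpha) || frozenR Q j.
Proof. by move: gT a'0; rewrite mem_range /inclusions /frozenR /alpha /=; lia. Qed.

Lemma frozenL_squeezeA j : j \in lineL T -> frozenL Q j = (j == alpha) || frozenL T j.
Proof. by move: gT a'0; rewrite mem_range /inclusions /frozenL /alpha /=; lia. Qed.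

Definition m_right := `|(iE T - fp T - (tf T)%:Z - (tc T)%:Z)%R|%N.
Definition e_right := (tf T - 1 - tc' T)%N.
Definition u_left := `|(fp T - iW T)%R|%N.

Definition chiR : rat :=
  rising e_right 0 * (rising (tc T) (0 + (e_right + tc' T)%N%:R) ^+ 2
   * rising m_right (0 + (e_right + tc' T + tc T)%N%:R)).
Definition chiL : rat := rising u_left 0.
Definition prodR : rat := \prod_(j <- [seq j <- lineR T | frozenR Q j]) dist alpha j.
Definition prodL : rat := \prod_(j <- [seq j <- lineL T | frozenL T j]) dist alpha j.

Lemma alphaR : alpha \in lineR T.
Proof. by move: gT a'0; rewrite mem_range /inclusions /alpha; clear; lia. Qed.
Lemma alphaL : alpha \in lineL T.
Proof. by move: gT a'0; rewrite mem_range /inclusions /alpha; clear; lia. Qed.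

Lemma edgesP Y : subseq Y (edges T) -> uniq Y /\ forall j, j \in Y ->
  [/\ j \in lineR T, j \in lineL T, j != alpha, ~~ frozenR Q j & ~~ frozenL T j].
Proof.
move=> HY; split; first exact: subseq_uniq HY (filter_uniq _ (range_uniq _ _)).
move=> j /(mem_subseq HY); rewrite mem_filter !mem_range => H.
by move: gT a'0 H; rewrite /inclusions /frozenR /frozenL /alpha /=; clear; split; lia.
Qed.

(** The half of [T] has one plain strip more, along AB, and its value of [hi] at the SE side is one
    lower. The two effects cancel on AB, so both halves have the same line of heights. *)
Lemma right_ratio Y : subseq Y (edges T) ->
  (transfer (stripsR T) (confR T Y))%:R * chiR
  = prodR * (\prod_(j <- Y) dist alpha j) * (transfer (stripsR Q) (confR Q Y))%:R.
Proof.
move=> HY; have [uY YP] := edgesP HY.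
have [n [phi [Hsys Hcnt]]] := @bowtie_system rat m_right (tc T) (tc' T) e_right.
have [g [gE g0]] := antidiff phi 0.
have A_alpha : (tc' T)%:Z + e_right%:Z = alpha.
  by move: gT a'0; rewrite /inclusions /alpha /e_right; clear; lia.
rewrite A_alpha in Hsys.
pose P j := frozenR Q j || (j \in Y).
have PA : ~~ P alpha.
  rewrite /P negb_or; apply/andP; split; last first.
    by apply/negP => /YP[_ _]; rewrite eqxx.
  by move: gT a'0; rewrite /inclusions /frozenR /alpha /=; clear; lia.
have confT : confR T Y = [seq j <- lineR T | (j == alpha) || P j].
  by apply: eq_in_filter => j /frozenR_squeezeA->; rewrite -orbA.
have confQ : confR Q Y = [seq j <- lineR T | P j] by rewrite /confR lineR_squeezeA.
have eT : (tf T - tc' T = e_right.+1)%N.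
  by move: gT a'0; rewrite /inclusions /e_right; clear; lia.
pose hi := sN T - iE T - fq T + m_right%:Z + (tc T)%:Z + (tc' T)%:Z + e_right%:Z.
have hiE : hi + 1 = sN T - fp T - fq T.
  by move: gT a'0; rewrite /inclusions /hi /e_right /m_right; clear; lia.
have ZT : (transfer (stripsR T) (confR T Y))%:R
    = ldet [seq row_mx (g s) (1 : 'rV[rat]_1) | s <- confR T Y].
  rewrite /stripsR eT.
  apply: (cnt_plain (hi := hi) _ gE); last by rewrite hiE; apply: filter_subseq.
    by move: gT a'0; rewrite /inclusions /hi /e_right /m_right; clear; lia.
  by apply: Hcnt; move: gT a'0; rewrite /inclusions /m_right; clear; lia.
have ZQ : (transfer (stripsR Q) (confR Q Y))%:R = ldet (map phi (confR Q Y)).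
  have mQ : `|(iE Q - fp Q - (tf Q)%:Z - (tc Q)%:Z)%R|%N = m_right.
    by move: gT a'0; rewrite /inclusions /m_right /=; clear; lia.
  rewrite /stripsR mQ.
  apply: Hcnt; try by move: gT gQ a'0; rewrite /inclusions /m_right /=; clear; lia.
  rewrite (_ : _ + e_right%:Z = sN Q - fp Q - fq Q); first exact: filter_subseq.
  by move: gT a'0; rewrite /inclusions /e_right /m_right /=; clear; lia.
rewrite ZT ZQ confT confQ (ldet_insert_range Hsys gE g0 alphaR PA).
congr (_ * _); rewrite /P prod_conf //.
- by move=> j /YP[].
- by move=> j /YP[].
Qed.

(** The roles are exchanged: the NW side moves outward, so the extra strip belongs to [Q], and
    inserting [alpha] leads from [T] to [Q]. *)
Lemma left_ratio Y : subseq Y (edges T) ->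
  (transfer (stripsL Q) (confL Q Y))%:R * chiL
  = prodL * (\prod_(j <- Y) dist alpha j) * (transfer (stripsL T) (confL T Y))%:R.
Proof.
move=> HY; have [uY YP] := edgesP HY.
have [n [phi [Hsys Hcnt]]] := @plain_system rat u_left alpha.
have [g [gE g0]] := antidiff phi 0.
pose P j := frozenL T j || (j \in Y).
have PA : ~~ P alpha.
  rewrite /P negb_or; apply/andP; split; last first.
    by apply/negP => /YP[_ _]; rewrite eqxx.
  by move: gT a'0; rewrite /inclusions /frozenL /alpha /=; clear; lia.
have confQ : confL Q Y = [seq j <- lineL T | (j == alpha) || P j].
  by rewrite /confL lineL_squeezeA; apply: eq_in_filter => j /frozenL_squeezeA->; rewrite -orbA.
have confT : confL T Y = [seq j <- lineL T | P j] by [].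
have uQ : `|(fp Q - iW Q)%R|%N = u_left.+1.
  by move: gT; rewrite /inclusions /u_left /=; clear; lia.
pose hi := jN T - fq T - 1.
have hiE : hi + 1 = jN Q - fq Q by rewrite /hi /=; clear; lia.
have ZT : (transfer (stripsL T) (confL T Y))%:R = ldet (map phi (confL T Y)).
  apply: Hcnt; first by move: gT; rewrite /inclusions; clear; lia.
  rewrite (_ : range _ _ = lineL T); first exact: filter_subseq.
  by congr range; move: gT; rewrite /inclusions /u_left; clear; lia.
have ZQ : (transfer (stripsL Q) (confL Q Y))%:R
    = ldet [seq row_mx (g s) (1 : 'rV[rat]_1) | s <- confL Q Y].
  pose h0 := jN Q - fq Q - (fp Q - iW Q).
  have hE : hi = h0 + u_left%:Z.
    by move: gT; rewrite /inclusions /hi /h0 /u_left /=; clear; lia.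
  rewrite /stripsL uQ -/h0 /= -hE.
  apply: (cnt_plain _ gE); last 1 first.
  - by rewrite hiE (_ : range _ _ = lineL Q) ?filter_subseq //; congr range => /=; clear; lia.
  - by move: gT gQ; rewrite /inclusions /hi /=; clear; lia.
  - by rewrite hE; apply: Hcnt; move: gQ; rewrite /inclusions /h0 /=; clear; lia.
rewrite ZT ZQ confT confQ (ldet_insert_range Hsys gE g0 alphaL PA).
congr (_ * _); rewrite /P prod_conf //.
- by move=> j /YP[].
- by move=> j /YP[].
Qed.

Lemma unit_ratio : (M (region T))%:R * (chiR * prodL) = (M (region Q))%:R * (chiL * prodR).
Proof.
rewrite !M_cut // edges_squeezeA !natr_sum !mulr_suml !big_seq; apply: eq_bigr => p Hp.
have HY := splits_subseq_r Hp; have := left_ratio HY; have := right_ratio HY.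
rewrite !natrM.
move: (transfer (stripsR T) _)%:R (transfer (stripsR Q) _)%:R (transfer (stripsL T) _)%:R
  (transfer (stripsL Q) _)%:R.
have : \prod_(j <- p.2) dist alpha j != 0.
  have [_ YP] := edgesP HY; rewrite prodf_seq_neq0; apply/allP => j /YP[_ _ ja _ _] /=.
  by rewrite /dist pnatr_eq0 absz_eq0 subr_eq0.
move: (\prod_(j <- p.2) _) => y y0 rT rQ lT lQ HR HL.
apply: (mulfI y0).
transitivity ((rT * chiR) * (prodL * y * lT)); first by ring.
by rewrite HR -HL; ring.
Qed.
End UnitSqueeze.

(** * The constant *)

Definition omega (T : triad) : rat := weight T * couple_ratio T.
Definition hyperq (n : nat) : rat := (hyperfact n)%:R.
Definition factq (n : nat) : rat := (n`!)%:R.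

Lemma hyperqS n : hyperq n.+1 = hyperq n * factq n.
Proof. by rewrite /hyperq /hyperfact big_ord_recr natrM. Qed.

Lemma factq_neq0 n : factq n != 0.
Proof. by rewrite /factq pnatr_eq0 -lt0n fact_gt0. Qed.

Lemma hyperq_neq0 n : hyperq n != 0.
Proof.
by elim: n => [|n IH]; rewrite ?hyperqS ?mulf_neq0 ?factq_neq0 // /hyperq /hyperfact big_ord0.
Qed.

Lemma omega_neq0 T : omega T != 0.
Proof.
have H := hyperq_neq0.
rewrite /omega /weight /couple_ratio /kappaA /kappaB /kappaC /kappaAB /kappaAC /kappaBC /Hd.
by rewrite !natrM; do ?[apply: mulf_neq0 | apply: invr_neq0 | exact: H].
Qed.

(* [omega] as a function of its numerical data: [n1 s1], [n2 s2], [n3 s3] are the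
   distances from [A], [B], [C]; [m1 r1], [m2 r2], [m3 r3] those from [BC], [AC], [AB]. *)
Definition omega_of (f a b c a' b' c' n1 s1 n2 s2 n3 s3 m1 r1 m2 r2 m3 r3 : nat) : rat :=
  hyperq f ^+ 4 * hyperq a * hyperq b * hyperq c * hyperq a' * hyperq b' * hyperq c'
  / (hyperq (f + a) * hyperq (f + b) * hyperq (f + c) * hyperq (f - a') * hyperq (f - b') *
    hyperq (f - c'))
  * (hyperq n1 * hyperq s1 * (hyperq n2 * hyperq s2) * (hyperq n3 * hyperq s3)
     / (hyperq m1 * hyperq r1 * (hyperq m2 * hyperq r2) * (hyperq m3 * hyperq r3))).

Lemma omegaE T : omega T = omega_of (tf T) (ta T) (tb T) (tc T) (ta' T) (tb' T) (tc' T)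
  `|(jN T - (ptA T).2)%R| `|((ptA T).2 - jS T)%R|
  `|(sN T - ((ptB T).1 + (ptB T).2))%R| `|((ptB T).1 + (ptB T).2 - sS T)%R|
  `|((ptC T).1 - iW T)%R| `|(iE T - (ptC T).1)%R|
  `|(jN T - fq T)%R| `|(fq T - jS T)%R|
  `|(sN T - (fp T + fq T + (tf T)%:Z))%R| `|(fp T + fq T + (tf T)%:Z - sS T)%R|
  `|(fp T - iW T)%R| `|(iE T - fp T)%R|.
Proof.
rewrite /omega /weight /couple_ratio /kappaA /kappaB /kappaC /kappaAB /kappaAC /kappaBC /Hd.
by rewrite !natrM /omega_of -/(hyperq _) !exprS expr0 mulr1.
Qed.

Lemma rising_ff k (m : nat) : rising k (m%:R : rat) * factq m = factq (m + k).
Proof.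
elim: k m => [|k IH] m; first by rewrite /rising big_ord0 mul1r addn0.
rewrite risingS natr1 -mulrA mulrCA (_ : m.+1%:R * factq m = factq m.+1); last first.
  by rewrite /factq -natrM factS.
by rewrite IH addSnnS.
Qed.

Lemma prod_below al x y : x <= y -> y <= al ->
  (\prod_(j <- range x y) dist al j) * factq `|(al - y)%R|%N = factq `|(al - x)%R|%N.
Proof.
move: x y; apply: range_ind => x y xy; first by move=> yx _; rewrite range_nil // big_nil mul1r;
  congr (factq `|_|%N); lia.
move=> IH _ yal; rewrite (range_cons xy) big_cons -mulrA IH //; last by lia.
rewrite (_ : `|(al - x)%R|%N = `|(al - (x + 1))%R|%N.+1); last by lia.
by rewrite /factq factS natrM /dist; congr (_%:R * _); lia.
Qed.

Lemma prod_above al x y : x <= y -> al < x ->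
  (\prod_(j <- range x y) dist al j) * factq `|(x - al - 1)%R|%N = factq `|(y - al - 1)%R|%N.
Proof.
move=> xy alx; have [k Hk] : exists k : nat, y = x + k%:Z by exists `|(y - x)%R|%N; lia.
rewrite Hk => {y xy Hk}; elim: k => [|k IH]; first by rewrite addr0 range_nil // big_nil mul1r.
rewrite (_ : x + k.+1%:Z = x + k%:Z + 1); last by lia.
rewrite range_rcons; last by lia.
rewrite big_cat big_seq1 /= mulrAC IH.
rewrite (_ : `|(x + k%:Z + 1 - al - 1)%R|%N = `|(x + k%:Z - al - 1)%R|%N.+1); last by lia.
by rewrite /factq factS natrM mulrC /dist; congr (_%:R * _); lia.
Qed.

(** One of the two intervals is empty, according to the side of AB on which the corner between the S
    and SW sides lies. This form covers both positions; [clip_above] does so for the corner between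
    N and NE. *)
Lemma clip_below al x y : x <= al -> y <= al ->
  (\prod_(j <- range x y) dist al j) * factq `|(al - y)%R|%N
  = (\prod_(j <- range y x) dist al j) * factq `|(al - x)%R|%N.
Proof.
move=> xa ya; have [xy|yx] := leP x y.
  by rewrite prod_below // range_nil // big_nil mul1r.
by rewrite (prod_below (ltW yx)) // range_nil ?(ltW yx) // big_nil mul1r.
Qed.

Lemma clip_above al x y : al < x -> al < y ->
  (\prod_(j <- range x y) dist al j) * factq `|(x - al - 1)%R|%N
  = (\prod_(j <- range y x) dist al j) * factq `|(y - al - 1)%R|%N.
Proof.
move=> xa ya; have [xy|yx] := leP x y.
  by rewrite prod_above // (@range_nil y) // big_nil mul1r.
by rewrite (prod_above (ltW yx)) // (@range_nil x) ?(ltW yx) // big_nil mul1r.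
Qed.

Section Constant.
Variable T : triad.
Hypotheses (gT : inclusions T) (gQ : inclusions (squeezeA 1 T)) (a'0 : (0 < ta' T)%N).
Let Q := squeezeA 1 T.
Let alpha : int := (tf T)%:Z - 1.

Lemma prodR_cat : prodR T =
  (\prod_(j <- range (jS T - fq T) (sS T - fp T - fq T)) dist alpha j) *
  (\prod_(j <- range 0 (tb' T)%:Z) dist alpha j) *
  (\prod_(j <- range ((tf T)%:Z - (ta' T)%:Z) alpha) dist alpha j) *
  (\prod_(j <- range (jN T - fq T) (sN T - fp T - fq T)) dist alpha j).
Proof.
rewrite -!big_cat /=; apply: perm_big; apply: uniq_perm.
- by rewrite filter_uniq ?range_uniq.
- rewrite !cat_uniq !range_uniq !andbT /=; do ?[apply/andP; split]; apply/hasPn => j;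
    by rewrite /= ?mem_cat !mem_range; move: gT a'0; rewrite /inclusions /alpha; clear; lia.
- move=> j; rewrite mem_filter !mem_cat !mem_range.
  by move: gT a'0; rewrite /inclusions /alpha /frozenR /=; clear; lia.
Qed.

Lemma prodL_cat : prodL T =
  (\prod_(j <- range (sS T - fp T - fq T) (jS T - fq T)) dist alpha j) *
  (\prod_(j <- range (- (tb T)%:Z) 0) dist alpha j) *
  (\prod_(j <- range (tf T)%:Z ((tf T)%:Z + (ta T)%:Z)) dist alpha j) *
  (\prod_(j <- range (sN T - fp T - fq T) (jN T - fq T)) dist alpha j).
Proof.
rewrite -!big_cat /=; apply: perm_big; apply: uniq_perm.
- by rewrite filter_uniq ?range_uniq.
- rewrite !cat_uniq !range_uniq !andbT /=; do ?[apply/andP; split]; apply/hasPn => j;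
    by rewrite /= ?mem_cat !mem_range; move: gT a'0; rewrite /inclusions /alpha; clear; lia.
- move=> j; rewrite mem_filter !mem_cat !mem_range.
  by move: gT a'0; rewrite /inclusions /alpha /frozenL /=; clear; lia.
Qed.

(** Each hyperfactorial affected has its argument changed by one, which produces a factorial. [x1]
    to [x6] stand for the distances that stay fixed, those of B, C and BC. *)
Lemma omega_unit (f a b c a' b' c' n s x1 x2 x3 x4 x5 x6 e e' u u' : nat) :
  (b' <= f)%N -> (c' <= f)%N ->
  omega_of f.+1 a b c a'.+1 b' c' n s.+1 x1 x2 x3 x4 x5 x6 e e'.+1 u u'.+1
    * (factq a * factq (f + b) * factq (f + c) * factq (f - b') * factq (f - c') * factq n *
      factq e' * factq u')
  = omega_of f a.+1 b c a' b' c' n.+1 s x1 x2 x3 x4 x5 x6 e.+1 e' u.+1 u'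
    * (factq f ^+ 4 * factq a' * factq s * factq e * factq u).
Proof.
move=> bf cf; rewrite /omega_of !subSS !subSn // !addSn addnS !hyperqS.
have H := hyperq_neq0; have H' := factq_neq0.
field.
by rewrite !H !H'.
Qed.

Lemma prodL_neq0 : prodL T != 0.
Proof.
rewrite /prodL prodf_seq_neq0; apply/allP => j; rewrite mem_filter => /andP[Hj _] /=.
rewrite /dist pnatr_eq0 absz_eq0 subr_eq0; apply: contraL Hj => /eqP->.
by move: gT a'0; rewrite /inclusions /frozenL; clear; lia.
Qed.

Lemma unit_squeeze : (M (region T))%:R * omega Q = (M (region Q))%:R * omega T.
Proof.
have H' := factq_neq0; have ff0 : factq 0 = 1 by [].
pose f := (tf T - 1)%N; pose a' := (ta' T - 1)%N.
pose n := `|(jN T - fq T - (tf T)%:Z)%R|%N.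
pose s := `|(fq T + f%:Z - jS T)%R|%N.
pose e := `|(sN T - fp T - fq T - (tf T)%:Z)%R|%N.
pose e' := `|(fp T + fq T + f%:Z - sS T)%R|%N.
pose u := `|(fp T - iW T)%R|%N.
pose u' := `|(iE T - fp T - 1)%R|%N.
have bf : (tb' T <= f)%N by move: gT a'0; rewrite /inclusions /f; clear; lia.
have cf : (tc' T <= f)%N by move: gT a'0; rewrite /inclusions /f; clear; lia.
have al : alpha = f%:Z by move: gT a'0; rewrite /inclusions /f /alpha; clear; lia.
have := @omega_unit f (ta T) (tb T) (tc T) a' (tb' T) (tc' T) n s
  `|(sN T - (fp T + fq T))%R|%N `|(fp T + fq T - sS T)%R|%N
  `|(fp T + (tf T)%:Z - iW T)%R|%N `|(iE T - (fp T + (tf T)%:Z))%R|%N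
  `|(jN T - fq T)%R|%N `|(fq T - jS T)%R|%N e e' u u' bf cf.
have -> : omega_of f.+1 (ta T) (tb T) (tc T) a'.+1 (tb' T) (tc' T) n s.+1
  `|(sN T - (fp T + fq T))%R|%N `|(fp T + fq T - sS T)%R|%N
  `|(fp T + (tf T)%:Z - iW T)%R|%N `|(iE T - (fp T + (tf T)%:Z))%R|%N
  `|(jN T - fq T)%R|%N `|(fq T - jS T)%R|%N e e'.+1 u u'.+1 = omega T.
  rewrite omegaE /=; congr omega_of;
    by move: gT a'0; rewrite /inclusions /f /a' /n /s /e /e' /u /u'; clear; lia.
have -> : omega_of f (ta T).+1 (tb T) (tc T) a' (tb' T) (tc' T) n.+1 s
  `|(sN T - (fp T + fq T))%R|%N `|(fp T + fq T - sS T)%R|%N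
  `|(fp T + (tf T)%:Z - iW T)%R|%N `|(iE T - (fp T + (tf T)%:Z))%R|%N
  `|(jN T - fq T)%R|%N `|(fq T - jS T)%R|%N e.+1 e' u.+1 u' = omega Q.
  rewrite omegaE /=; congr omega_of;
    by move: gT a'0; rewrite /inclusions /f /a' /n /s /e /e' /u /u'; clear; lia.
set X := (factq (ta T) * _ * _ * _ * _ * _ * _ * _); set Y := (_ * factq a' * _ * _ * _) => HXY.
have HM := unit_ratio gT gQ a'0.
(* The outer lobe contributes ((f + c)! / f!)^2, one factor for each of its sides; the strips to its
   right contribute u'! / (f + c)!, and those between AB and the inner lobe (f - c')!. *)
have chiRE : chiR T * factq f ^+ 2 = factq (f - tc' T) * factq (f + tc T) * factq u'.
  have ef : (e_right T + tc' T = f)%N by rewrite /e_right subnK.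
  have := rising_ff (e_right T) 0; have := rising_ff (tc T) f.
  have := rising_ff (m_right T) (f + tc T).
  rewrite (_ : (f + tc T + m_right T)%N = u'); last first.
    by move: gT a'0; rewrite /inclusions /f /m_right /u'; clear; lia.
  rewrite /chiR !add0r ef ff0 mulr1 add0n => E1 E2 E3.
  have E3' : rising (e_right T) (0 : rat) = factq (f - tc' T) by rewrite E3.
  by rewrite E3' -E1 -E2; ring.
have chiLE : chiL T = factq u.
  by have := rising_ff u 0; rewrite ff0 mulr1 add0n.
have pLE := prodL_cat; have pRE := prodR_cat; rewrite al in pLE pRE.
move: pLE pRE.
have C1 := @clip_below f (jS T - fq T) (sS T - fp T - fq T).
have C2 := @clip_above f (jN T - fq T) (sN T - fp T - fq T).
have D1 := @prod_below f 0 (tb' T).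
have D2 := @prod_below f ((tf T)%:Z - (ta' T)%:Z) f.
have D3 := @prod_below f (- (tb T)%:Z) 0.
have D4 := @prod_above f (tf T) ((tf T)%:Z + (ta T)%:Z).
move: C1; rewrite (_ : `|(f%:Z - (sS T - fp T - fq T))%R|%N = e'); last by rewrite /e'; clear;
  lia.
rewrite (_ : `|(f%:Z - (jS T - fq T))%R|%N = s); last by rewrite /s; clear; lia.
move=> C1; move: C2.
have ftf : tf T = f.+1 by move: gT a'0; rewrite /inclusions /f; clear; lia.
rewrite (_ : `|(jN T - fq T - f%:Z - 1)%R|%N = n); last by rewrite /n ftf; clear; lia.
rewrite (_ : `|(sN T - fp T - fq T - f%:Z - 1)%R|%N = e); last by rewrite /e ftf; clear; lia.
move=> C2; move: D1.
rewrite (_ : `|(f%:Z - (tb' T)%:Z)%R|%N = (f - tb' T)%N); last by move: bf; clear; lia.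
rewrite (_ : `|(f%:Z - 0)%R|%N = f); last by clear; lia.
move=> D1; move: D2; rewrite (_ : `|(f%:Z - f%:Z)%R|%N = 0%N); last by clear; lia.
rewrite (_ : `|(f%:Z - ((tf T)%:Z - (ta' T)%:Z))%R|%N = a'); last first.
  by move: gT a'0; rewrite /inclusions /f /a'; clear; lia.
move=> D2; move: D3; rewrite (_ : `|(f%:Z - 0)%R|%N = f); last by clear; lia.
rewrite (_ : `|(f%:Z - - (tb T)%:Z)%R|%N = (f + tb T)%N); last by clear; lia.
move=> D3; move: D4; rewrite (_ : `|((tf T)%:Z - f%:Z - 1)%R|%N = 0%N); last by rewrite ftf;
  clear; lia.
rewrite (_ : `|((tf T)%:Z + (ta T)%:Z - f%:Z - 1)%R|%N = ta T); last by rewrite ftf; clear; lia.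
rewrite ff0 mulr1 => D4; rewrite ff0 mulr1 in D2.
have k1 : jS T - fq T <= f%:Z by move: gT a'0; rewrite /inclusions /f; clear; lia.
have k2 : sS T - fp T - fq T <= f%:Z by move: gT a'0; rewrite /inclusions /f; clear; lia.
have k3 : f%:Z < jN T - fq T by move: gT a'0; rewrite /inclusions /f; clear; lia.
have k4 : f%:Z < sN T - fp T - fq T by move: gT a'0; rewrite /inclusions /f; clear; lia.
have k5 : (tf T)%:Z - (ta' T)%:Z <= f%:Z by move: a'0; rewrite ftf; clear; lia.
have k6 : - (tb T)%:Z <= 0 by clear; lia.
have k7 : 0 <= f%:Z by [].
have k8 : 0 <= (tb' T)%:Z by [].
have k9 : (tf T)%:Z <= (tf T)%:Z + (ta T)%:Z by clear; lia.
have k10 : f%:Z < (tf T)%:Z by rewrite ftf; clear; lia.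
have {}C1 := C1 k1 k2; have {}C2 := C2 k3 k4; have {}D1 := D1 k8 bf.
have {}D2 := D2 k5 (lexx _); have {}D3 := D3 k6 k7; have {}D4 := D4 k9 k10.
rewrite D2 D4.
have divE (x y z : rat) : z != 0 -> x * z = y -> x = y / z by move=> z0 <-; rewrite mulfK.
move/divE: C1 => -> //; move/divE: C2 => -> //.
move/divE: D1 => -> //; move/divE: D3 => -> //.
(* The clipped stretches now appear as the same two products in [prodL] and [prodR], so they can
   stay abstract. *)
move: (\prod_(j <- range (sS T - fp T - fq T) (jS T - fq T)) dist f j) => B2.
move: (\prod_(j <- range (sN T - fp T - fq T) (jN T - fq T)) dist f j) => T2 pLE pRE.
have KE : (chiR T * prodL T) * Y = (chiL T * prodR T) * X.
  have {}chiRE : chiR T = factq (f - tc' T) * factq (f + tc T) * factq u' / factq f ^+ 2.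
    by apply: divE; rewrite ?expf_neq0.
  rewrite chiRE chiLE pLE pRE /X /Y; field; by rewrite !H'.
have chiR0 : chiR T != 0.
  apply: contra_neq (mulf_neq0 (mulf_neq0 (H' (f - tc' T)%N) (H' (f + tc T)%N)) (H' u')) => R0.
  by rewrite -chiRE R0 mul0r.
have Y0 : Y != 0 by rewrite /Y !mulf_neq0 ?expf_neq0 ?H'.
have K0 : chiR T * prodL T * Y != 0 by rewrite mulf_neq0 // mulf_neq0 // prodL_neq0.
apply: (mulIf K0).
transitivity (((M (region T))%:R * (chiR T * prodL T)) * (omega Q * Y)); first by ring.
by rewrite HM -HXY KE; ring.
Qed.
End Constant.

(** * Arbitrary squeezings *)

(** Cross-multiplied, the relation composes along squeezings without any knowledge that intermediate
    regions are tileable; transitivity cancels only [omega], which is never 0. *)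
Definition same_ratio (T Q : triad) : Prop :=
  (M (region T))%:R * omega Q = (M (region Q))%:R * omega T.

Lemma same_ratio_sym T Q : same_ratio T Q -> same_ratio Q T.
Proof. by rewrite /same_ratio => ->. Qed.

Lemma same_ratio_trans T2 T1 T3 : same_ratio T1 T2 -> same_ratio T2 T3 -> same_ratio T1 T3.
Proof.
rewrite /same_ratio => H1 H2; apply: (mulIf (omega_neq0 T2)).
by rewrite mulrAC H1 mulrAC H2; ring.
Qed.

Lemma same_ratio_squeezeA d T : (d <= ta' T)%N -> inclusions T -> inclusions (squeezeA d T) ->
  same_ratio T (squeezeA d T).
Proof.
elim: d => [|d IH] da gT gS.
  rewrite (_ : squeezeA 0 T = T) //; case: T {gT gS da} => *; rewrite /squeezeA /=.
  by congr Triad; rewrite ?subr0 ?addr0 ?addn0 ?subn0.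
(* All the inequalities are affine in the amount squeezed, so they hold in between once they hold at
   both ends. *)
have gd : inclusions (squeezeA d T) by move: gT gS da; rewrite /inclusions /=; clear; lia.
have E : squeezeA d.+1 T = squeezeA 1 (squeezeA d T) by rewrite /squeezeA /=; congr Triad;
  clear; lia.
rewrite E in gS *; apply: (same_ratio_trans (IH (ltnW da) gT gd)).
by apply: unit_squeeze; rewrite //= subn_gt0.
Qed.

(* Rotation by 120 degrees, (i, j) -> (j, - i - j), taking B, C, A to A, B, C. *)
Definition rot_triad (T : triad) : triad :=
  Triad (ty T) (tz T) (tx T) (tb T) (tc T) (ta T) (tb' T) (tc' T) (ta' T) (tf T)
    (fq T) (- (fp T + fq T + (tf T)%:Z))
    (- sS T) (- sN T) (- iW T) (- iE T) (jN T) (jS T).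

Definition rot_tri (t : tri) : tri :=
  (t.1.1, t.2, - t.1.2 - t.2 - (if t.1.1 then 1 else 2)).

Lemma rot_tri_inj : injective rot_tri.
Proof.
move=> [[b i] j] [[b' i'] j'] [] -> ->.
by case: b' => /addIr/addIr/oppr_inj->.
Qed.

Lemma inclusions_rot T : inclusions T -> inclusions (rot_triad T).
Proof. by rewrite /inclusions /=; lia. Qed.

Lemma mem_region_rot T b i j :
  ((b, i, j) \in region (rot_triad T)) = ((b, i, j) \in map rot_tri (region T)).
Proof.
have -> : (b, i, j) = rot_tri (b, - i - j - (if b then 1 else 2), i).
  by congr (_, _, _) => /=; lia.
rewrite (mem_map rot_tri_inj) !mem_region /rot_tri /lobeA_out_bot /lobeA_in_bl
  /lobeB_in_bl /lobeB_out_bot /lobeC_in_bl /lobeC_out_bot /ptA /ptB /ptC /=.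
case: b; rewrite ?up_in_H ?up_in_up ?up_in_down ?down_in_H ?down_in_up ?down_in_down /=.
  lia.
lia.
Qed.

Lemma M_rot T : M (region (rot_triad T)) = M (region T).
Proof.
rewrite !M_matchings.
have uni r : uniq (ups r) by rewrite filter_uniq ?undup_uniq.
have und r : uniq (downs r) by rewrite filter_uniq ?undup_uniq.
have Hu : perm_eq (ups (region (rot_triad T))) (map rot_tri (ups (region T))).
  apply: uniq_perm; rewrite ?(map_inj_uniq rot_tri_inj) // => -[[b i] j].
  rewrite /ups mem_filter mem_undup mem_region_rot /=.
  apply/andP/mapP => [[bt /mapP[t tT Et]]|[t]].
    by exists t => //; rewrite mem_filter mem_undup tT andbT; case: Et bt => ->.
  rewrite mem_filter mem_undup => /andP[t1 tT] Et.
  by rewrite Et map_f // -t1; case: Et => ->.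
have Hd : perm_eq (downs (region (rot_triad T))) (map rot_tri (downs (region T))).
  apply: uniq_perm; rewrite ?(map_inj_uniq rot_tri_inj) // => -[[b i] j].
  rewrite /downs mem_filter mem_undup mem_region_rot /=.
  apply/andP/mapP => [[bt /mapP[t tT Et]]|[t]].
    by exists t => //; rewrite mem_filter mem_undup tT andbT; case: Et bt => ->.
  rewrite mem_filter mem_undup => /andP[t1 tT] Et.
  by rewrite Et map_f // -t1; case: Et => ->.
rewrite (matchings_perm_l _ _ (uni _) Hu) (matchings_perm_r _ _ (und _) Hd).
apply: matchings_map_in => -[[b i] j] [[b' i'] j'].
rewrite !mem_filter /= => /andP[b1 _] /andP[b2 _].
by case: b b' b1 b2 => [] [] // _ _; rewrite /rot_tri !adjE /=; clear; lia.
Qed.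

Lemma omega_rot T : omega (rot_triad T) = omega T.
Proof.
rewrite !omegaE /=.
transitivity (omega_of (tf T) (tb T) (tc T) (ta T) (tb' T) (tc' T) (ta' T)
  `|((ptB T).1 + (ptB T).2 - sS T)%R| `|(sN T - ((ptB T).1 + (ptB T).2))%R|
  `|((ptC T).1 - iW T)%R| `|(iE T - (ptC T).1)%R|
  `|((ptA T).2 - jS T)%R| `|(jN T - (ptA T).2)%R|
  `|(fp T + fq T + (tf T)%:Z - sS T)%R| `|(sN T - (fp T + fq T + (tf T)%:Z))%R|
  `|(fp T - iW T)%R| `|(iE T - fp T)%R|
  `|(fq T - jS T)%R| `|(jN T - fq T)%R|).
  by congr omega_of; rewrite /=; lia.
by rewrite /omega_of; congr (_ / _ * (_ / _)); ring.
Qed.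

Lemma same_ratio_rot T Q : same_ratio (rot_triad T) (rot_triad Q) -> same_ratio T Q.
Proof. by rewrite /same_ratio !M_rot !omega_rot. Qed.

Lemma same_ratio_squeeze T Q : inclusions T -> inclusions Q -> squeeze_out T Q -> same_ratio T Q.
Proof.
move=> gT gQ [d [[da E]|[db E]|[dc E]]].
- have EQ : Q = squeezeA d T by rewrite E.
  by rewrite EQ in gQ *; apply: same_ratio_squeezeA.
- have EQ : rot_triad Q = squeezeA d (rot_triad T).
    have df : (d <= tf T)%N by move: gT db; rewrite /inclusions; clear; lia.
    by rewrite E /rot_triad /squeezeA /=; congr Triad; clear -df; lia.
  by apply: same_ratio_rot; rewrite EQ; apply: same_ratio_squeezeA => //; rewrite -?EQ;
    apply: inclusions_rot.
- have EQ : rot_triad (rot_triad Q) = squeezeA d (rot_triad (rot_triad T)).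
    have df : (d <= tf T)%N by move: gT dc; rewrite /inclusions; clear; lia.
    by rewrite E /rot_triad /squeezeA /=; congr Triad; clear -df; lia.
  do 2 apply: same_ratio_rot; rewrite EQ; apply: same_ratio_squeezeA => //; rewrite -?EQ;
    by do 2 apply: inclusions_rot.
Qed.

Lemma same_ratio_seq T Q : squeeze_seq T Q -> same_ratio T Q.
Proof.
elim=> {T Q} // T T' T'' [oT oT' H] _; apply: same_ratio_trans.
have [gT gT'] := (triad_inclusions oT, triad_inclusions oT').
by case: H => H; [|apply: same_ratio_sym]; apply: same_ratio_squeeze.
Qed.

Unset Implicit Arguments.
Set Strict Implicit.

Theorem theorem2p2 (R Q : triad) :
  triad_ok R ->
  (0 < M (region R))%N ->
  squeeze_seq R Q ->
  (M (region R))%:R / (M (region Q))%:R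
    = (weight R * couple_ratio R) / (weight Q * couple_ratio Q) :> rat.
Proof.
move=> _ MR /same_ratio_seq; rewrite /same_ratio -/(omega R) -/(omega Q) => H.
have wR := omega_neq0 R; have wQ := omega_neq0 Q.
have MR0 : (M (region R))%:R != 0 :> rat by rewrite pnatr_eq0 -lt0n.
(* Tileability of [Q] is a consequence of the cross-multiplied identity and that of [R]. *)
have MQ0 : (M (region Q))%:R != 0 :> rat.
  by apply: contraNneq (mulf_neq0 MR0 wQ) => MQ; rewrite H MQ mul0r.
by apply/eqP; rewrite eqr_div // H mulrC.
Qed.
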